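(* For $w\in\mathbb{R}$, $w\geq0$, let $J(w)$ be the self-adjoint Jacobi operator on $\ell^2(\mathbb{N})$ with diagonal entries $1,2,3,\dots$ and with all entries on the two parallels neighboring the diagonal equal to $w$, and let $\lambda_1(w)<\lambda_2(w)<\cdots$ be its eigenvalues in ascending order. For $s\in\mathbb{N}$ and $0\leq w\leq\beta_s$, where $$\beta_s=\left(\frac{(s-1)!\,s!}{\pi}\right)^{1/(2s)},$$ one has $$0\leq s-\lambda_s(w)\leq\frac{1}{\pi}\arcsin\left(\frac{\pi w^{2s}}{(s-1)!\,s!}\right).$$
   Context: $J(w)=L+wT$, where $L$ is the diagonal operator with diagonal sequence $n$, $n\in\mathbb{N}$ (on its maximal domain), and $T$ is the bounded operator whose matrix has all units on the two parallels neighboring the diagonal and zeros elsewhere. For all $w\in\mathbb{R}$ the spectrum of $J(w)$ is semibounded below, discrete and simple, with $\lambda_s(0)=s$. *)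

(* Defs.v *)
(* Stdlib reals and Coquelicot complex numbers and series. *)
From Stdlib Require Import Reals Factorial.
From Coquelicot Require Import Coquelicot.
Open Scope R_scope.

(* Elements of the complex space l^2({1,2,3,...}) are sequences [v : nat -> C]
   with [v n] the coordinate of index [n + 1]. *)
Definition l2 (v : nat -> C) : Prop := ex_series (fun n => Cmod (v n) ^ 2).

Definition L (v : nat -> C) : nat -> C := fun n => (RtoC (INR (S n)) * v n)%C.

Definition T (v : nat -> C) : nat -> C :=
  fun n => (match n with O => RtoC 0 | S m => v m end + v (S n))%C.

Definition J (w : R) (v : nat -> C) : nat -> C :=
  fun n => (L v n + RtoC w * T v n)%C.

(* [T] is bounded, so the domain of [J w] is the maximal domain of [L],
   whatever [w]. *)
Definition dom_J (v : nat -> C) : Prop := l2 v /\ l2 (L v).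

Definition is_eigenvalue_J (w : R) (z : C) : Prop :=
  exists v : nat -> C,
    dom_J v /\
    (exists n, v n <> RtoC 0) /\
    (forall n, J w v n = (z * v n)%C).

(* The enumeration starts at 1; the value [lam 0] is irrelevant. *)
Definition ascending_eigenvalues_J (w : R) (lam : nat -> R) : Prop :=
  (forall i j : nat, (1 <= i)%nat -> (i < j)%nat -> lam i < lam j) /\
  (forall z : C,
     is_eigenvalue_J w z <->
     exists s : nat, (1 <= s)%nat /\ z = RtoC (lam s)).

Definition beta (s : nat) : R :=
  Rpower (INR (fact (s - 1)) * INR (fact s) / PI) (1 / (2 * INR s)).

(* Main.v *)
Require Import Defs.
From Stdlib Require Import Reals Factorial Lra Lia.
From Coquelicot Require Import Coquelicot.
Open Scope R_scope.

(* Up to normalisation, the solution of the eigenvalue recurrence that decays at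
   infinity has entries [(- w) ^ n * h_n (mu, w ^ 2)], where [h_n] is the Bessel
   function of order [n - mu], and for [w > 0] the eigenvalues are the zeros [mu]
   of [h_0].  The number of sign changes of [h_0, h_1, ...] is locally constant in
   [mu] and [w] as long as [h_0] does not vanish, and it increases by one when
   [mu] passes a zero of [h_0]; hence it counts the eigenvalues below [mu].
   For [mu = s] the symmetry [J_(-m) = (-1) ^ m J_m] yields at least [s] sign
   changes, so that [lambda_s <= s].  For [mu = s - d] with
   [sin (pi d) = pi w ^ (2 s) / ((s - 1)! s!)], Taylor's formula in [w ^ 2] shows
   that [h_0] does not vanish for any smaller coupling either, so the number of
   sign changes is the one at [w = 0], namely at most [s - 1], and
   [lambda_s >= s - d]. *)

(** * Rescaled Bessel functions *)

(** The sine comes from Euler's product. At [mu = s - d] the first [s] Taylor terms of [h_0] in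
    [y = w ^ 2] share one sign. The remainder is governed by [h_s], a Bessel function of positive
    order [d], which an energy argument bounds by its value at [y = 0]. After removal of common
    factors, nonvanishing means [y ^ s / s! < d * head]. On the critical curve the left side is
    [(s - 1)! sin (pi d) / pi], and Euler's product, cut after [s - 1] factors, puts this strictly
    below [d (s - 1)!] times the product of the [1 - (d / i) ^ 2]. Strictness is what admits the
    endpoint [w = beta s]. The obstacle is to bound the head below by [(s - 1)!] times that product.
    For larger [y] this follows from a truncated exponential; smaller [y] are reached by scaling
    from the threshold, and that the threshold itself is admissible is a numerical inequality
    between harmonic numbers and factorials, where [d <= 1 / 2] enters. No Gamma function is used:
    normalising at an index [N], chosen large once [s] and [w] are known, leaves only finite
    products. *)

Fixpoint rising (x : R) (k : nat) : R :=
  match k with O => 1 | S j => rising x j * (x + INR j) end.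

Fixpoint sum_lt (f : nat -> R) (k : nat) : R :=
  match k with O => 0 | S j => sum_lt f j + f j end.

Lemma rising_S_l (x : R) (k : nat) : rising x (S k) = x * rising (x + 1) k.
Proof.
  induction k as [|k IH].
  - simpl; ring.
  - change (rising x (S (S k))) with (rising x (S k) * (x + INR (S k))).
    rewrite IH, S_INR; simpl; ring.
Qed.

Lemma rising_pos (x : R) (k : nat) : 0 < x -> 0 < rising x k.
Proof.
  intros Hx; induction k as [|k IH]; simpl; [lra|].
  apply Rmult_lt_0_compat; [exact IH|]; pose proof (pos_INR k); lra.
Qed.

Lemma continuous_rising (f : R -> R) (k : nat) (t : R) :
  continuous f t -> continuous (fun u => rising (f u) k) t.
Proof.
  intros Hf; induction k as [|k IH]; simpl; [apply continuous_const|].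
  apply (continuous_mult (fun u => rising (f u) k) (fun u => f u + INR k)).
  - exact IH.
  - apply (continuous_plus f (fun _ => INR k)); [exact Hf | apply continuous_const].
Qed.

Lemma sum_lt_ext (f g : nat -> R) (k : nat) :
  (forall i, (i < k)%nat -> f i = g i) -> sum_lt f k = sum_lt g k.
Proof.
  induction k as [|k IH]; intros H; simpl; [reflexivity|].
  rewrite IH, H by auto with arith; reflexivity.
Qed.

Lemma sum_lt_le (f g : nat -> R) (k : nat) :
  (forall i, (i < k)%nat -> f i <= g i) -> sum_lt f k <= sum_lt g k.
Proof.
  induction k as [|k IH]; intros H; simpl; [lra|].
  apply Rplus_le_compat; auto with arith.
Qed.

Lemma sum_lt_scal (c : R) (f : nat -> R) (k : nat) :
  sum_lt (fun i => c * f i) k = c * sum_lt f k.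
Proof. induction k as [|k IH]; simpl; [ring | rewrite IH; ring]. Qed.

Lemma sum_lt_S_l (f : nat -> R) (k : nat) :
  sum_lt f (S k) = f O + sum_lt (fun i => f (S i)) k.
Proof.
  induction k as [|k IH]; [simpl; ring|].
  change (sum_lt f (S (S k))) with (sum_lt f (S k) + f (S k)).
  rewrite IH; simpl; ring.
Qed.

Lemma sum_lt_pos (f : nat -> R) (k : nat) :
  (forall i, (i < k)%nat -> 0 <= f i) -> 0 <= sum_lt f k.
Proof.
  induction k as [|k IH]; intros H; simpl; [lra|].
  apply Rplus_le_le_0_compat; auto with arith.
Qed.

Lemma continuous_sum_lt (f : nat -> R -> R) (k : nat) (t : R) :
  (forall i, continuous (f i) t) -> continuous (fun u => sum_lt (fun i => f i u) k) t.
Proof.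
  intros H; induction k as [|k IH]; simpl; [apply continuous_const|].
  apply (continuous_plus (fun u => sum_lt (fun i => f i u) k) (f k)); auto.
Qed.

(* [q N mu n] stands for the quotient of Gamma(N + 1 - mu) by Gamma(n + 1 - mu),
   which only involves finitely many factors. *)
Definition q (N : nat) (mu : R) (n : nat) : R :=
  rising (INR n + 1 - mu) (N - n) / rising (INR N + 1 - mu) (n - N).

(* Up to a factor depending only on [mu] and [w], [(w ^ n) * h N mu n (w ^ 2)]
   is the Bessel function of order [n - mu] at [2 * w]. *)
Definition h_coef (N : nat) (mu : R) (n k : nat) : R :=
  (-1) ^ k * q N mu (n + k) / INR (fact k).

Definition h (N : nat) (mu : R) (n : nat) (y : R) : R := PSeries (h_coef N mu n) y.

Lemma q_N (N : nat) (mu : R) : q N mu N = 1.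
Proof. unfold q; rewrite Nat.sub_diag; simpl; field. Qed.

Lemma q_rec (N : nat) (mu : R) (n : nat) :
  mu < INR N + 1 -> q N mu n = (INR n + 1 - mu) * q N mu (S n).
Proof.
  intros Hmu; unfold q.
  destruct (Nat.lt_ge_cases n N) as [Hn|Hn].
  - replace (N - n)%nat with (S (N - S n)) by lia.
    replace (n - N)%nat with 0%nat by lia.
    replace (S n - N)%nat with 0%nat by lia.
    rewrite rising_S_l, S_INR.
    replace (INR n + 1 - mu + 1) with (INR n + 1 + 1 - mu) by ring.
    simpl; field.
  - replace (N - n)%nat with 0%nat by lia.
    replace (N - S n)%nat with 0%nat by lia.
    replace (S n - N)%nat with (S (n - N)) by lia.
    simpl; rewrite minus_INR by assumption.
    pose proof (le_INR _ _ Hn).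
    assert (0 < rising (INR N + 1 - mu) (n - N)) by (apply rising_pos; lra).
    field; split; lra.
Qed.

Lemma q_pos (N : nat) (mu : R) (n : nat) :
  mu < INR N + 1 -> mu < INR n + 1 -> 0 < q N mu n.
Proof.
  intros HN Hn; unfold q.
  apply Rdiv_lt_0_compat; apply rising_pos; lra.
Qed.

(** Every factor beyond [N] is at least [D]. The choice [D = 1] gives a uniform bound;
    [D = 2 + 2 * y] outweighs the powers of [y] in the Wronskian and of [w] in the eigenvector. *)
Lemma q_bound_tail (N : nat) (mu D : R) (k : nat) :
  0 < D -> D <= INR N + 1 - mu -> q N mu (N + k) <= / D ^ k.
Proof.
  intros HD HN; induction k as [|k IH].
  - rewrite Nat.add_0_r, q_N; simpl; lra.
  - rewrite Nat.add_succ_r.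
    rewrite (q_rec N mu (N + k)) in IH by lra.
    set (x := q N mu (S (N + k))) in *.
    assert (Hx : 0 < x).
    { apply q_pos; [lra|]. rewrite S_INR, plus_INR. pose proof (pos_INR k); lra. }
    assert (D * x <= / D ^ k).
    { eapply Rle_trans; [|exact IH]. apply Rmult_le_compat_r; [lra|].
      rewrite plus_INR; pose proof (pos_INR k); lra. }
    assert (0 < D ^ k) by (apply pow_lt; lra).
    simpl. rewrite Rinv_mult.
    apply (Rmult_le_reg_l D); [lra|].
    replace (D * (/ D * / D ^ k)) with (/ D ^ k) by (field; split; lra). lra.
Qed.

Lemma q_bounded (N : nat) (mu : R) :
  mu < INR N + 1 -> exists M, forall n, Rabs (q N mu n) <= M.
Proof.
  intros Hmu.
  assert (Hfin : forall k, exists M, forall n, (n <= N + k)%nat -> Rabs (q N mu n) <= M).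
  { intros k; induction (N + k)%nat as [|m [M HM]].
    - exists (Rabs (q N mu 0)); intros n Hn; replace n with 0%nat by lia; lra.
    - exists (Rmax M (Rabs (q N mu (S m)))); intros n Hn.
      destruct (Nat.eq_dec n (S m)) as [->|Hne]; [apply Rmax_r|].
      eapply Rle_trans; [apply HM; lia | apply Rmax_l]. }
  (* From index [N + 1] on, the factor in [q_rec] exceeds 1, so [Rabs (q N mu n)] no longer
     grows. *)
  destruct (Hfin 1%nat) as [M HM]; exists M; intros n.
  destruct (Nat.le_gt_cases n (N + 1)) as [Hn|Hn]; [apply HM; lia|].
  replace n with (N + 1 + (n - N - 1))%nat by lia.
  induction (n - N - 1)%nat as [|k IH]; [rewrite Nat.add_0_r; apply HM; lia|].
  rewrite Nat.add_succ_r; eapply Rle_trans; [|exact IH].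
  rewrite (q_rec N mu (N + 1 + k)), Rabs_mult by lra.
  pose proof (Rabs_pos (q N mu (S (N + 1 + k)))).
  pose proof (Rle_abs (INR (N + 1 + k) + 1 - mu)).
  rewrite !plus_INR in *; simpl in *; pose proof (pos_INR k); nra.
Qed.

Lemma continuous_q (N n : nat) (mu : R) :
  mu < INR N + 1 -> continuous (fun m => q N m n) mu.
Proof.
  intros Hmu; unfold q, Rdiv.
  assert (Hc : forall c, continuous (fun m : R => c - m) mu).
  { intros c; apply (continuous_minus (fun _ => c) (fun m => m));
      [apply continuous_const | apply continuous_id]. }
  apply (continuous_mult (fun m => rising (INR n + 1 - m) (N - n))
                         (fun m => / rising (INR N + 1 - m) (n - N))).
  - apply (continuous_rising (fun m => INR n + 1 - m)); apply Hc.
  - apply continuous_comp with (g := fun x => / x).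
    + apply (continuous_rising (fun m => INR N + 1 - m)); apply Hc.
    + apply continuous_Rinv, Rgt_not_eq, rising_pos; lra.
Qed.

Lemma h_coef_radius (N : nat) (mu : R) (n : nat) :
  mu < INR N + 1 -> CV_radius (h_coef N mu n) = p_infty.
Proof.
  intros Hmu.
  destruct (q_bounded N mu Hmu) as [M HM].
  assert (Hr : forall r : R, Rbar_le r (CV_radius (h_coef N mu n))).
  { intros r; apply (proj1 (CV_radius_bounded (h_coef N mu n))).
    destruct (maj_by_pos _ (exist _ 0 (cv_speed_pow_fact r))) as [B [HB HrB]].
    exists (M * B); intros k; unfold h_coef.
    replace ((-1) ^ k * q N mu (n + k) / INR (fact k) * r ^ k)
      with ((-1) ^ k * q N mu (n + k) * (r ^ k / INR (fact k)))
      by (field; apply INR_fact_neq_0).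
    rewrite !Rabs_mult, pow_1_abs, Rmult_1_l.
    apply Rmult_le_compat; auto using Rabs_pos. }
  destruct (CV_radius (h_coef N mu n)) as [r| |]; [|reflexivity|].
  - specialize (Hr (r + 1)); simpl in Hr; lra.
  - specialize (Hr 0); contradiction.
Qed.

Lemma h_coef_ex (N : nat) (mu : R) (n : nat) (y : R) :
  mu < INR N + 1 -> ex_pseries (h_coef N mu n) y.
Proof. intros H; apply CV_radius_inside; rewrite h_coef_radius by assumption; exact I. Qed.

Lemma h_0 (N : nat) (mu : R) (n : nat) : h N mu n 0 = q N mu n.
Proof. unfold h; rewrite PSeries_0; unfold h_coef; rewrite Nat.add_0_r; simpl; field. Qed.

(** Coefficientwise, [q_rec] produces the factor [n + k + 1 - mu]; its part [k] cancels against [k!]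
    and shifts the series by one power of [y]. *)
Lemma h_rec (N : nat) (mu : R) (n : nat) (y : R) :
  mu < INR N + 1 ->
  h N mu n y = (INR n + 1 - mu) * h N mu (S n) y - y * h N mu (S (S n)) y.
Proof.
  intros Hmu; unfold h.
  replace ((INR n + 1 - mu) * PSeries (h_coef N mu (S n)) y
           - y * PSeries (h_coef N mu (S (S n))) y)
    with ((INR n + 1 - mu) * PSeries (h_coef N mu (S n)) y
          + (-1) * (y * PSeries (h_coef N mu (S (S n))) y)) by ring.
  rewrite <- PSeries_incr_1, <- !PSeries_scal, <- PSeries_plus.
  - apply PSeries_ext; intros k.
    unfold PS_plus, PS_scal, PS_incr_1, h_coef, plus, scal; simpl; unfold mult; simpl.
    destruct k as [|k].
    + unfold zero; simpl; rewrite Nat.add_0_r, (q_rec N mu n) by assumption; field.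
    + rewrite (q_rec N mu (n + S k)), Nat.add_succ_r by assumption.
      change (fact k + k * fact k)%nat with (fact (S k)).
      rewrite fact_simpl, mult_INR, !S_INR, plus_INR; simpl.
      pose proof (INR_fact_neq_0 k); pose proof (pos_INR k); field; split; [assumption|lra].
  - apply ex_pseries_scal; [apply Rmult_comm | apply h_coef_ex; assumption].
  - apply ex_pseries_scal; [apply Rmult_comm|].
    apply ex_pseries_incr_1, h_coef_ex; assumption.
Qed.

Lemma is_derive_h (N : nat) (mu : R) (n : nat) (y : R) :
  mu < INR N + 1 -> is_derive (h N mu n) y (- h N mu (S n) y).
Proof.
  intros Hmu; unfold h.
  rewrite <- PSeries_opp.
  rewrite (PSeries_ext (PS_opp (h_coef N mu (S n))) (PS_derive (h_coef N mu n))).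
  - apply is_derive_PSeries; rewrite h_coef_radius by assumption; exact I.
  - intros k; unfold PS_opp, PS_derive, h_coef.
    rewrite Nat.add_succ_r, fact_simpl, mult_INR; unfold opp; simpl (opp _).
    pose proof (INR_fact_neq_0 k); pose proof (pos_INR k); rewrite S_INR in *; simpl.
    field; split; [assumption|lra].
Qed.

Lemma derive_nonneg_le (f df : R -> R) (y : R) :
  0 <= y -> (forall x, 0 <= x <= y -> is_derive f x (df x)) ->
  (forall x, 0 <= x <= y -> 0 <= df x) -> f 0 <= f y.
Proof.
  intros Hy Hd Hpos.
  destruct (MVT_gen f 0 y df) as [c [Hc E]].
  - intros x; rewrite Rmin_left, Rmax_right by lra; intros; apply Hd; lra.
  - intros x; rewrite Rmin_left, Rmax_right by lra; intros Hx.
    apply continuity_pt_filterlim, (ex_derive_continuous f x).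
    exists (df x); apply Hd; lra.
  - rewrite Rmin_left, Rmax_right in Hc by lra.
    specialize (Hpos c Hc); nra.
Qed.

(* As a function of [y], [u := h N mu n] satisfies [y u'' + (n + 1 - mu) u' + u = 0],
   so the energy [u ^ 2 + y u' ^ 2] has derivative [- (1 + 2 (n - mu)) u' ^ 2]. *)
Lemma h_abs_le (N : nat) (mu : R) (n : nat) (y : R) :
  mu < INR N + 1 -> - (1 / 2) <= INR n - mu -> 0 <= y ->
  Rabs (h N mu n y) <= Rabs (q N mu n).
Proof.
  intros Hmu Hn Hy.
  (* [E] is minus the energy, so that it is nondecreasing. *)
  set (E := fun x => - (h N mu n x ^ 2 + x * h N mu (S n) x ^ 2)).
  assert (HE : E 0 <= E y).
  { apply derive_nonneg_le with (df := fun x => (1 + 2 * (INR n - mu)) * h N mu (S n) x ^ 2).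
    - assumption.
    - intros x Hx; unfold E.
      pose proof (is_derive_h N mu n x Hmu) as D0.
      pose proof (is_derive_h N mu (S n) x Hmu) as D1.
      auto_derive.
      + repeat split; eexists; eassumption.
      + change (fun z : R => h N mu n z) with (h N mu n).
        change (fun z : R => h N mu (S n) z) with (h N mu (S n)).
        rewrite (is_derive_unique _ _ _ D0), (is_derive_unique _ _ _ D1).
        rewrite (h_rec N mu n x) by assumption; ring.
    - intros x Hx; apply Rmult_le_pos; [lra | apply pow2_ge_0]. }
  unfold E in HE; rewrite !h_0 in HE.
  apply Rsqr_le_abs_0; unfold Rsqr.
  assert (0 <= y * h N mu (S n) y ^ 2) by (apply Rmult_le_pos; [lra | apply pow2_ge_0]).
  lra.
Qed.

(** * Taylor expansion in the squared coupling *)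

Definition taylor (N : nat) (mu : R) (n K : nat) (y : R) : R :=
  sum_lt (fun k => (-1) ^ k * q N mu (n + k) * y ^ k / INR (fact k)) K.

Lemma taylor_S (N : nat) (mu : R) (n K : nat) (y : R) :
  taylor N mu n (S K) y =
  taylor N mu n K y + (-1) ^ K * q N mu (n + K) * y ^ K / INR (fact K).
Proof. reflexivity. Qed.

Lemma is_derive_pow_div_fact (k : nat) (y : R) :
  is_derive (fun x => x ^ S k / INR (fact (S k))) y (y ^ k / INR (fact k)).
Proof.
  auto_derive; [exact I|].
  change (fact k + k * fact k)%nat with (fact (S k)).
  rewrite fact_simpl, mult_INR; pose proof (INR_fact_neq_0 k).
  destruct k; [simpl; field|].
  pose proof (pos_INR (S k)); rewrite (S_INR (S k)) in *; simpl pred; field; split; [assumption|lra].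
Qed.

Lemma is_derive_taylor (N : nat) (mu : R) (n K : nat) (y : R) :
  is_derive (taylor N mu n (S K)) y (- taylor N mu (S n) K y).
Proof.
  induction K as [|K IH].
  - unfold taylor; simpl. auto_derive; [exact I | ring].
  - rewrite (taylor_S N mu (S n)).
    apply is_derive_ext with (f := fun x => plus (taylor N mu n (S K) x)
      (((-1) ^ S K * q N mu (n + S K)) * (x ^ S K / INR (fact (S K))))).
    { intros t; rewrite (taylor_S N mu n (S K)); unfold plus; simpl; unfold Rdiv; ring. }
    replace (- (taylor N mu (S n) K y + (-1) ^ K * q N mu (S n + K) * y ^ K / INR (fact K)))
      with (plus (- taylor N mu (S n) K y)
             (((-1) ^ S K * q N mu (n + S K)) * (y ^ K / INR (fact K)))).
    + apply (is_derive_plus (taylor N mu n (S K))); [exact IH|].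
      apply is_derive_scal, is_derive_pow_div_fact.
    + rewrite Nat.add_succ_r; unfold plus; simpl; unfold Rdiv; ring.
Qed.

Lemma taylor_at_0 (N : nat) (mu : R) (n K : nat) : taylor N mu n (S K) 0 = q N mu n.
Proof.
  induction K as [|K IH].
  - unfold taylor; simpl; rewrite Nat.add_0_r; field.
  - rewrite taylor_S, IH, pow_i by lia; unfold Rdiv; ring.
Qed.

Lemma h_taylor (N : nat) (mu : R) (K n : nat) (y B : R) :
  mu < INR N + 1 -> 0 <= y ->
  (forall x, 0 <= x <= y -> Rabs (h N mu (n + K) x) <= B) ->
  Rabs (h N mu n y - taylor N mu n K y) <= B * (y ^ K / INR (fact K)).
Proof.
  intros Hmu; revert n y; induction K as [|K IH]; intros n y Hy HB.
  - rewrite Nat.add_0_r in HB; unfold taylor; simpl; rewrite Rminus_0_r.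
    replace (B * (1 / 1)) with B by field; apply HB; lra.
  - assert (IH' : forall x, 0 <= x <= y ->
      Rabs (h N mu (S n) x - taylor N mu (S n) K x) <= B * (x ^ K / INR (fact K))).
    { intros x Hx; apply IH; [lra|]; intros z Hz.
      replace (S n + K)%nat with (n + S K)%nat by lia; apply HB; lra. }
    assert (Hsign : forall e, e = 1 \/ e = -1 ->
      0 <= e * (h N mu n y - taylor N mu n (S K) y) + B * (y ^ S K / INR (fact (S K)))).
    { intros e He.
      set (F := fun x => plus (e * (minus (h N mu n x) (taylor N mu n (S K) x)))
                              (B * (x ^ S K / INR (fact (S K))))).
      assert (HF : F 0 <= F y).
      { apply derive_nonneg_le with (df := fun x =>
          plus (e * minus (- h N mu (S n) x) (- taylor N mu (S n) K x))
               (B * (x ^ K / INR (fact K)))); [assumption| |].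
        - intros x Hx; unfold F.
          apply (is_derive_plus (fun x => e * minus (h N mu n x) (taylor N mu n (S K) x))).
          + apply is_derive_scal.
            apply (is_derive_minus (h N mu n) (taylor N mu n (S K))).
            * apply is_derive_h; assumption.
            * apply is_derive_taylor.
          + apply is_derive_scal, is_derive_pow_div_fact.
        - intros x Hx; specialize (IH' x Hx).
          apply Rabs_le_between in IH'.
          unfold plus, minus, opp; simpl; unfold plus, opp; simpl.
          destruct He as [-> | ->]; lra. }
      unfold F in HF; rewrite h_0, taylor_at_0 in HF.
      unfold plus, minus, opp in HF; simpl in HF; unfold plus, opp in HF; simpl in HF.
      simpl; lra. }
    pose proof (Hsign 1 (or_introl eq_refl)); pose proof (Hsign (-1) (or_intror eq_refl)).
    apply Rabs_le_between; lra.
Qed.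

(** One Taylor term suffices: [h_n >= q_n - y q_(n+1) = (n + 1 - mu - y) q_(n+1)]. *)
Lemma h_pos (N : nat) (mu : R) (n : nat) (y : R) :
  mu < INR N + 1 -> - (1 / 2) <= INR n - mu -> 0 <= y < INR n + 1 - mu -> 0 < h N mu n y.
Proof.
  intros Hmu Hn Hy.
  assert (Hq : 0 < q N mu (S n)) by (apply q_pos; rewrite ?S_INR; lra).
  pose proof (h_taylor N mu 1 n y (q N mu (S n)) Hmu (proj1 Hy)) as HT.
  assert (HB : forall x, 0 <= x <= y -> Rabs (h N mu (n + 1) x) <= q N mu (S n)).
  { intros x Hx; replace (n + 1)%nat with (S n) by lia.
    rewrite <- (Rabs_pos_eq (q N mu (S n))) by lra.
    apply h_abs_le; rewrite ?S_INR; lra. }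
  specialize (HT HB); apply Rabs_le_between in HT.
  unfold taylor in HT; simpl in HT; rewrite Nat.add_0_r in HT.
  rewrite (q_rec N mu n) in HT by assumption.
  nra.
Qed.

(** * Continuity in the spectral parameter *)

Lemma continuous_of_uniform_approx (f : R -> R) (g : nat -> R -> R) (e : nat -> R) (x : R) :
  (forall k, continuous (g k) x) ->
  locally x (fun t => forall k, Rabs (f t - g k t) <= e k) ->
  is_lim_seq e 0 -> continuous f x.
Proof.
  intros Hg Hfg He; apply filterlim_locally; intros eps.
  apply is_lim_seq_spec in He.
  assert (Heps : 0 < eps / 3) by (pose proof (cond_pos eps); lra).
  destruct (He (mkposreal _ Heps)) as [K HK]; specialize (HK K (le_n K)); simpl in HK.
  rewrite Rminus_0_r in HK; apply Rabs_def2 in HK.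
  pose proof (proj1 (filterlim_locally (g K) (g K x)) (Hg K) (mkposreal _ Heps)) as HgK.
  pose proof (locally_singleton _ _ Hfg K) as Hx.
  generalize (filter_and _ _ Hfg HgK); apply filter_imp; intros t [Ht Htg].
  specialize (Ht K).
  unfold ball in *; simpl in *; unfold AbsRing_ball, abs, minus, plus, opp in *; simpl in *.
  apply Rabs_le_between in Ht; apply Rabs_le_between in Hx.
  apply Rabs_def2 in Htg; apply Rabs_def1; lra.
Qed.

Lemma locally_lt (x a : R) : x < a -> locally x (fun t => t < a).
Proof. intros H; apply (open_lt a x H). Qed.

(** For [n >= N] the orders stay positive near [mu], so [h_(n+K)] is bounded by 1 and the Taylor
    polynomials converge uniformly in [mu]. *)
Lemma continuous_h_tail (N : nat) (mu : R) (n : nat) (y : R) :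
  mu < INR N -> (N <= n)%nat -> 0 <= y -> continuous (fun m => h N m n y) mu.
Proof.
  intros Hmu Hn Hy.
  apply (continuous_of_uniform_approx _ (fun K m => taylor N m n K y)
           (fun K => y ^ K / INR (fact K))).
  - intros K; unfold taylor.
    apply (continuous_sum_lt (fun k m => (-1) ^ k * q N m (n + k) * y ^ k / INR (fact k))).
    intros k; unfold Rdiv.
    apply (continuous_mult (fun m => (-1) ^ k * q N m (n + k) * y ^ k)); [|apply continuous_const].
    apply (continuous_mult (fun m => (-1) ^ k * q N m (n + k))); [|apply continuous_const].
    apply (continuous_mult (fun m => (-1) ^ k)); [apply continuous_const|].
    apply continuous_q; lra.
  - apply filter_imp with (2 := locally_lt _ _ Hmu); intros m Hm K.
    apply le_INR in Hn.
    rewrite <- (Rmult_1_l (y ^ K / INR (fact K))).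
    apply h_taylor; [lra | assumption|].
    intros x Hx; eapply Rle_trans; [apply h_abs_le; rewrite ?plus_INR; pose proof (pos_INR K); lra|].
    apply INR_le in Hn.
    rewrite Rabs_pos_eq.
    2:{ left; apply q_pos; [lra|].
        apply le_INR in Hn; rewrite plus_INR; pose proof (pos_INR K); lra. }
    replace (n + K)%nat with (N + (n + K - N))%nat by lia.
    eapply Rle_trans; [apply (q_bound_tail N m 1); lra|].
    rewrite pow1; lra.
  - apply is_lim_seq_Reals, cv_speed_pow_fact.
Qed.

(** Continuity descends below [N] through the recurrence, two consecutive indices at a time. *)
Lemma continuous_h_mu (N : nat) (mu : R) (n : nat) (y : R) :
  mu < INR N -> 0 <= y -> continuous (fun m => h N m n y) mu.
Proof.
  intros Hmu Hy.
  assert (H : forall k n, (N <= n + k)%nat ->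
    continuous (fun m => h N m n y) mu /\ continuous (fun m => h N m (S n) y) mu).
  { induction k as [|k IH]; intros p Hp.
    - split; apply continuous_h_tail; (assumption || lia).
    - destruct (IH (S p)) as [H1 H2]; [lia|]; split; [|exact H1].
      apply continuous_ext_loc with
        (g := fun m : R => plus ((INR p + 1 - m) * h N m (S p) y) (- (y * h N m (S (S p)) y))).
      + apply filter_imp with (2 := locally_lt _ _ Hmu); intros m Hm.
        rewrite (h_rec N m p) by lra; unfold plus; simpl; ring.
      + apply (continuous_plus (fun m => (INR p + 1 - m) * h N m (S p) y)
                               (fun m => opp (y * h N m (S (S p)) y))).
        * apply (continuous_mult (fun m => INR p + 1 - m)); [|exact H1].
          apply (continuous_minus (fun _ => INR p + 1) (fun m => m));
            [apply continuous_const | apply continuous_id].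
        * apply (continuous_opp (fun m => y * h N m (S (S p)) y)).
          apply (continuous_mult (fun _ => y)); [apply continuous_const | exact H2]. }
  apply (H N n); lia.
Qed.

Lemma continuous_h_y (N : nat) (mu : R) (n : nat) (y : R) :
  mu < INR N + 1 -> continuous (h N mu n) y.
Proof. intros H; apply (ex_derive_continuous (h N mu n)); eexists; apply is_derive_h, H. Qed.

(** * Counting sign changes *)

(* A zero counts as a change when it is reached but not when it is left.  Inside
   a solution of the recurrence the two neighbours of a zero have opposite signs,
   so the count is stable there; a zero of the first term is not counted. *)
Definition sign_change (x z : R) : nat :=
  if Req_EM_T z 0 then 1%nat else if Rlt_dec (x * z) 0 then 1%nat else 0%nat.

Fixpoint sign_changes (a : nat -> R) (n k : nat) : nat :=
  match k with
  | O => 0%nat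
  | S j => (sign_change (a n) (a (S n)) + sign_changes a (S n) j)%nat
  end.

Lemma sign_change_1 (x z : R) : x * z < 0 -> sign_change x z = 1%nat.
Proof. intros H; unfold sign_change; destruct (Req_EM_T z 0), (Rlt_dec (x * z) 0); auto; lra. Qed.

Lemma sign_change_0 (x z : R) : z <> 0 -> 0 <= x * z -> sign_change x z = 0%nat.
Proof. intros H H'; unfold sign_change; destruct (Req_EM_T z 0), (Rlt_dec (x * z) 0); auto; lra. Qed.

Lemma sign_change_zero (x : R) : sign_change x 0 = 1%nat.
Proof. unfold sign_change; destruct (Req_EM_T 0 0); auto; lra. Qed.

Lemma sign_change_le (x z : R) : (sign_change x z <= 1)%nat.
Proof. unfold sign_change; destruct (Req_EM_T z 0), (Rlt_dec (x * z) 0); auto. Qed.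

Lemma sign_changes_app (a : nat -> R) (n k j : nat) :
  sign_changes a n (k + j) = (sign_changes a n k + sign_changes a (n + k) j)%nat.
Proof.
  revert n; induction k as [|k IH]; intros n; simpl; [rewrite Nat.add_0_r; reflexivity|].
  rewrite IH, Nat.add_succ_r; simpl; lia.
Qed.

Lemma sign_changes_le (a : nat -> R) (n k : nat) : (sign_changes a n k <= k)%nat.
Proof.
  revert n; induction k as [|k IH]; intros n; simpl; [lia|].
  pose proof (sign_change_le (a n) (a (S n))); specialize (IH (S n)); lia.
Qed.

Lemma sign_changes_pos (a : nat -> R) (n k : nat) :
  (forall i, (n <= i)%nat -> 0 < a i) -> sign_changes a n k = 0%nat.
Proof.
  revert n; induction k as [|k IH]; intros n H; simpl; [reflexivity|].
  rewrite sign_change_0, IH; auto with arith.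
  - assert (0 < a (S n)) by auto; lra.
  - left; apply Rmult_lt_0_compat; auto.
Qed.

Lemma locally_same_sign (f : R -> R) (x : R) :
  continuous f x -> f x <> 0 -> locally x (fun t => 0 < f t * f x).
Proof.
  intros Hf Hx.
  assert (Hc : continuous (fun t => f t * f x) x).
  { apply (continuous_mult f (fun _ => f x)); [exact Hf | apply continuous_const]. }
  apply Hc, (open_gt 0); nra.
Qed.

(** At a zero of [a x] the induction must jump over two indices, hence the paired statement for [k]
    and [S k]. The outer neighbours have opposite signs, so wherever the perturbed middle term
    falls, the two steps together contribute exactly one change. *)
Lemma sign_changes_stable (a : R -> nat -> R) (N : nat) (x : R) :
  (forall n, continuous (fun t => a t n) x) ->
  locally x (fun t => forall n, (N <= n)%nat -> 0 < a t n) ->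
  (forall n, a x (S n) = 0 -> a x n * a x (S (S n)) < 0) ->
  forall k n, (N <= n + k)%nat -> a x n <> 0 ->
    locally x (fun t => sign_changes (a t) n k = sign_changes (a x) n k).
Proof.
  intros Hc Htail Hzero.
  assert (Hpos := locally_singleton _ _ Htail).
  assert (Hbase : forall n, a x n <> 0 -> a x (S n) <> 0 ->
    locally x (fun t => sign_change (a t n) (a t (S n)) = sign_change (a x n) (a x (S n)))).
  { intros n Hn HSn.
    generalize (filter_and _ _ (locally_same_sign _ x (Hc n) Hn)
                               (locally_same_sign _ x (Hc (S n)) HSn)).
    apply filter_imp; intros t [H1 H2].
    assert (0 < (a t n * a t (S n)) * (a x n * a x (S n))).
    { replace ((a t n * a t (S n)) * (a x n * a x (S n)))
        with ((a t n * a x n) * (a t (S n) * a x (S n))) by ring.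
      apply Rmult_lt_0_compat; assumption. }
    assert (a t (S n) <> 0) by (intros E; rewrite E in H2; lra).
    destruct (Rlt_le_dec (a x n * a x (S n)) 0).
    - rewrite !sign_change_1; try reflexivity; [assumption | nra].
    - rewrite !sign_change_0; try reflexivity; auto; nra. }
  assert (H : forall k, (forall n, (N <= n + k)%nat -> a x n <> 0 ->
      locally x (fun t => sign_changes (a t) n k = sign_changes (a x) n k)) /\
    (forall n, (N <= n + S k)%nat -> a x n <> 0 ->
      locally x (fun t => sign_changes (a t) n (S k) = sign_changes (a x) n (S k)))).
  { induction k as [|k [IH1 IH2]].
    - split; intros n Hn Hx; simpl; [apply filter_forall; reflexivity|].
      assert (a x (S n) <> 0) by (apply Rgt_not_eq, Hpos; lia).
      generalize (Hbase n Hx H); apply filter_imp; intros t ->; reflexivity.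
    - split; [exact IH2|]; intros n Hn Hx.
      destruct (Req_EM_T (a x (S n)) 0) as [E|E].
      + pose proof (Hzero n E) as Hop.
        assert (HSS : a x (S (S n)) <> 0) by (intros E'; rewrite E' in Hop; lra).
        assert (Hloc := IH1 (S (S n)) ltac:(lia) HSS).
        generalize (filter_and _ _ Hloc (filter_and _ _ (locally_same_sign _ x (Hc n) Hx)
                                (locally_same_sign _ x (Hc (S (S n))) HSS))).
        apply filter_imp; intros t [H0 [H1 H2]].
        change (sign_changes (a t) n (S (S k))) with
          (sign_change (a t n) (a t (S n)) +
           (sign_change (a t (S n)) (a t (S (S n))) + sign_changes (a t) (S (S n)) k))%nat.
        change (sign_changes (a x) n (S (S k))) with
          (sign_change (a x n) (a x (S n)) +
           (sign_change (a x (S n)) (a x (S (S n))) + sign_changes (a x) (S (S n)) k))%nat.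
        rewrite H0, E, sign_change_zero, (sign_change_0 0) by (auto; lra).
        assert (HtSS : a t (S (S n)) <> 0) by (intros E'; rewrite E' in H2; lra).
        assert (Hopt : a t n * a t (S (S n)) < 0).
        { assert (0 < (a t n * a t (S (S n))) * (a x n * a x (S (S n)))).
          { replace ((a t n * a t (S (S n))) * (a x n * a x (S (S n))))
              with ((a t n * a x n) * (a t (S (S n)) * a x (S (S n)))) by ring.
            apply Rmult_lt_0_compat; assumption. }
          nra. }
        clear - HtSS Hopt.
        set (p := a t n) in *; set (z := a t (S n)); set (r := a t (S (S n))) in *.
        destruct (total_order_T (z * r) 0) as [[Hz|Hz]|Hz].
        * rewrite (sign_change_1 z r) by assumption.
          rewrite (sign_change_0 p z); [lia| |].
          -- intros E; rewrite E in Hz; lra.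
          -- assert (0 < (p * z) * (r * r)) by nra. nra.
        * assert (E : z = 0) by (apply Rmult_integral in Hz; tauto).
          rewrite E, sign_change_zero, sign_change_0 by (auto; lra); reflexivity.
        * rewrite (sign_change_0 z r) by (auto; lra).
          rewrite (sign_change_1 p z); [lia|].
          assert ((p * z) * (r * r) < 0) by nra. nra.
      + generalize (filter_and _ _ (Hbase n Hx E) (IH2 (S n) ltac:(lia) E)).
        apply filter_imp; intros t [H1 H2].
        change (sign_changes (a t) n (S (S k))) with
          (sign_change (a t n) (a t (S n)) + sign_changes (a t) (S n) (S k))%nat.
        change (sign_changes (a x) n (S (S k))) with
          (sign_change (a x n) (a x (S n)) + sign_changes (a x) (S n) (S k))%nat.
        rewrite H1, H2; reflexivity. }
  intros k; apply (H k).
Qed.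

(** Read as a real function, [f] has derivative zero; this stands in for connectedness of the
    interval. *)
Lemma locally_constant (f : R -> nat) (a b : R) :
  a <= b -> (forall t, a <= t <= b -> locally t (fun u => f u = f t)) -> f a = f b.
Proof.
  intros Hab Hf.
  destruct (Req_EM_T a b) as [->|Hne]; [reflexivity|].
  apply INR_eq.
  apply (eq_is_derive (fun t => INR (f t))); [|lra].
  intros t Ht.
  apply is_derive_ext_loc with (f := fun _ => INR (f t)).
  - generalize (Hf t Ht); apply filter_imp; intros u ->; reflexivity.
  - apply (is_derive_const (INR (f t))).
Qed.

(** * Oscillation: how the count varies with [mu] *)

Lemma h_consecutive_zeros (N : nat) (mu : R) (n : nat) (y : R) :
  0 < y -> mu < INR N - 1 - 2 * y -> ~ (h N mu n y = 0 /\ h N mu (S n) y = 0).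
Proof.
  intros Hy Hmu H.
  assert (Hall : forall k, h N mu (n + k) y = 0 /\ h N mu (S (n + k)) y = 0).
  { induction k as [|k [IH1 IH2]]; [rewrite Nat.add_0_r; exact H|].
    rewrite Nat.add_succ_r; split; [exact IH2|].
    pose proof (h_rec N mu (n + k) y ltac:(lra)) as E.
    rewrite IH1, IH2 in E; nra. }
  destruct (Hall N) as [E _].
  assert (0 < h N mu (n + N) y); [|lra].
  apply h_pos; rewrite ?plus_INR; pose proof (pos_INR n); lra.
Qed.

Lemma h_interior_zero (N : nat) (mu : R) (n : nat) (y : R) :
  0 < y -> mu < INR N - 1 - 2 * y -> h N mu (S n) y = 0 ->
  h N mu n y * h N mu (S (S n)) y < 0.
Proof.
  intros Hy Hmu E.
  pose proof (h_consecutive_zeros N mu (S n) y Hy Hmu) as HS.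
  assert (0 < Rsqr (h N mu (S (S n)) y)) as Hsq by (apply Rlt_0_sqr; tauto).
  rewrite (h_rec N mu n), E by lra; unfold Rsqr in Hsq; nra.
Qed.

(** The bound [mu < INR N - 1 - 2 * y], used from here on, says [N + 1 - mu > 2 + 2 * y]: from index
    [N] on the entries are positive and, by [q_bound_tail], decay at least like the powers of
    [/ (2 + 2 * y)]. *)
Lemma h_tail_pos (N : nat) (mu : R) (n : nat) (y : R) :
  0 <= y -> mu < INR N - 1 - 2 * y -> (N <= n)%nat -> 0 < h N mu n y.
Proof. intros Hy Hmu Hn; apply le_INR in Hn; apply h_pos; lra. Qed.

(** The Casorati determinant of two solutions with different spectral parameters; its recurrence is
    a Christoffel-Darboux identity. *)
Definition wronskian (N : nat) (x t : R) (n : nat) (y : R) : R :=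
  h N x n y * h N t (S n) y - h N x (S n) y * h N t n y.

Lemma wronskian_rec (N : nat) (x t : R) (n : nat) (y : R) :
  x < INR N + 1 -> t < INR N + 1 ->
  wronskian N x t n y =
  (t - x) * (h N x (S n) y * h N t (S n) y) + y * wronskian N x t (S n) y.
Proof.
  intros Hx Ht; unfold wronskian.
  rewrite (h_rec N x n), (h_rec N t n) by assumption; ring.
Qed.

Lemma wronskian_sum (N : nat) (x t : R) (n K : nat) (y : R) :
  x < INR N + 1 -> t < INR N + 1 ->
  wronskian N x t n y =
  (t - x) * sum_lt (fun j => y ^ j * (h N x (S (n + j)) y * h N t (S (n + j)) y)) K
  + y ^ K * wronskian N x t (n + K) y.
Proof.
  intros Hx Ht; induction K as [|K IH]; simpl; [rewrite Nat.add_0_r; ring|].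
  rewrite IH, (wronskian_rec N x t (n + K)), Nat.add_succ_r by assumption; ring.
Qed.

(** Summing from [N] to infinity, all products are positive, and the boundary term vanishes in the
    limit because [y / (2 + 2 * y) <= 1 / 2]. *)
Lemma wronskian_tail_sign (N : nat) (x t y : R) :
  0 <= y -> x < INR N - 1 - 2 * y -> t < INR N - 1 - 2 * y ->
  0 <= (t - x) * wronskian N x t N y.
Proof.
  intros Hy Hx Ht.
  assert (Hlow : forall K, - (2 * Rabs (t - x) * (1 / 2) ^ K) <= (t - x) * wronskian N x t N y).
  { intros K.
    assert (Hsum : 0 <= sum_lt (fun j => y ^ j * (h N x (S (N + j)) y * h N t (S (N + j)) y)) K).
    { apply sum_lt_pos; intros i _.
      apply Rmult_le_pos; [apply pow_le; assumption|].
      left; apply Rmult_lt_0_compat; apply h_tail_pos; (assumption || lia). }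
    rewrite (wronskian_sum N x t N K) by lra.
    set (S0 := sum_lt _ K) in *; clearbody S0.
    assert (Hb : forall u, u < INR N - 1 - 2 * y -> forall j,
               Rabs (h N u (N + j) y) <= / (2 + 2 * y) ^ j).
    { intros u Hu j.
      assert (INR N <= INR (N + j)) by (apply le_INR; lia).
      eapply Rle_trans; [apply h_abs_le; lra|].
      rewrite Rabs_pos_eq; [apply q_bound_tail; lra | left; apply q_pos; lra]. }
    assert (H1 : forall u, u < INR N - 1 - 2 * y -> Rabs (h N u (S (N + K)) y) <= 1).
    { intros u Hu; rewrite <- Nat.add_succ_r; eapply Rle_trans; [apply Hb; assumption|].
      rewrite <- Rinv_1; apply Rinv_le_contravar; [lra | apply pow_R1_Rle; lra]. }
    assert (HW : Rabs (wronskian N x t (N + K) y) <= 2 * / (2 + 2 * y) ^ K).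
    { unfold wronskian.
      eapply Rle_trans; [apply Rabs_triang|]; rewrite Rabs_Ropp, !Rabs_mult.
      pose proof (Hb x Hx K); pose proof (Hb t Ht K); pose proof (H1 x Hx); pose proof (H1 t Ht).
      pose proof (Rabs_pos (h N x (N + K) y)); pose proof (Rabs_pos (h N t (N + K) y)).
      pose proof (Rabs_pos (h N x (S (N + K)) y)); pose proof (Rabs_pos (h N t (S (N + K)) y)).
      nra. }
    assert (HyK : Rabs (y ^ K * wronskian N x t (N + K) y) <= 2 * (1 / 2) ^ K).
    { rewrite Rabs_mult, Rabs_pos_eq by (apply pow_le; assumption).
      apply Rle_trans with (y ^ K * (2 * / (2 + 2 * y) ^ K)).
      - apply Rmult_le_compat_l; [apply pow_le|]; assumption.
      - replace (y ^ K * (2 * / (2 + 2 * y) ^ K)) with (2 * (y * / (2 + 2 * y)) ^ K).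
        + apply Rmult_le_compat_l; [lra|]; apply pow_incr; split.
          * apply Rmult_le_pos; [lra | left; apply Rinv_0_lt_compat; lra].
          * apply Rmult_le_reg_r with (2 + 2 * y); [lra|].
            rewrite Rmult_assoc, Rinv_l by lra; lra.
        + rewrite Rpow_mult_distr, pow_inv; ring. }
    rewrite Rmult_plus_distr_l, <- Rmult_assoc.
    assert (0 <= (t - x) * (t - x) * S0) by (apply Rmult_le_pos; [apply Rle_0_sqr | assumption]).
    assert (Rabs ((t - x) * (y ^ K * wronskian N x t (N + K) y)) <=
            Rabs (t - x) * (2 * (1 / 2) ^ K)).
    { rewrite Rabs_mult; apply Rmult_le_compat_l; [apply Rabs_pos | assumption]. }
    apply Rabs_le_between in H0; lra. }
  change (Rbar_le 0 ((t - x) * wronskian N x t N y)).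
  apply (is_lim_seq_le (fun K => - (2 * Rabs (t - x) * (1 / 2) ^ K))
           (fun _ => (t - x) * wronskian N x t N y)); [exact Hlow | | apply is_lim_seq_const].
  replace (Finite 0) with (Rbar_mult (- (2 * Rabs (t - x))) 0) by (simpl; f_equal; ring).
  apply is_lim_seq_ext with (u := fun K => (- (2 * Rabs (t - x))) * (1 / 2) ^ K); [intros; ring|].
  apply is_lim_seq_scal_l, is_lim_seq_geom; rewrite Rabs_pos_eq; lra.
Qed.

Definition node_count (N : nat) (mu y : R) : nat := sign_changes (fun n => h N mu n y) 0 N.

Lemma h_sign_changes_stable (N : nat) (x y : R) (n k : nat) :
  0 < y -> x < INR N - 1 - 2 * y -> (N <= n + k)%nat -> h N x n y <> 0 ->
  locally x (fun t => sign_changes (fun i => h N t i y) n k = sign_changes (fun i => h N x i y) n k).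
Proof.
  intros Hy Hx Hk Hn.
  apply (sign_changes_stable (fun t i => h N t i y) N x); try assumption.
  - intros i; apply continuous_h_mu; lra.
  - generalize (locally_lt _ _ Hx); apply filter_imp; intros t Ht i Hi.
    apply h_tail_pos; (assumption || lra).
  - intros i; apply h_interior_zero; assumption.
Qed.

(** Since [h_0] vanishes at [x], the Wronskian at index 0 reduces to minus the product of
    [h N x 1 y] and [h N t 0 y], and summation gives it the sign of [t - x]. So [h_0] and [h_1] have
    equal signs just left of [x] and opposite signs just right of it; the remaining changes are
    stable. *)
Lemma node_count_jump (N : nat) (x y : R) :
  0 < y -> x < INR N - 1 - 2 * y -> (1 <= N)%nat -> h N x 0 y = 0 ->
  locally x (fun t => (x < t -> node_count N t y = S (node_count N x y)) /\
                      (t < x -> node_count N t y = node_count N x y)).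
Proof.
  intros Hy Hx HN E.
  assert (E1 : h N x 1 y <> 0).
  { intros E1; apply (h_consecutive_zeros N x 0 y Hy Hx); split; assumption. }
  assert (Hloc := h_sign_changes_stable N x y 1 (N - 1) Hy Hx ltac:(lia) E1).
  assert (Hsame := locally_same_sign (fun t => h N t 1 y) x
                     (continuous_h_mu N x 1 y ltac:(lra) ltac:(lra)) E1).
  (* At [t = x] this is a sum of squares whose first term is positive; continuity keeps it positive
     nearby. *)
  set (sum := fun t => sum_lt (fun j => y ^ j * (h N x (S (0 + j)) y * h N t (S (0 + j)) y)) N).
  assert (Hsum : locally x (fun t => 0 < sum t)).
  { assert (Hc : continuous sum x).
    { apply (continuous_sum_lt (fun j t => y ^ j * (h N x (S (0 + j)) y * h N t (S (0 + j)) y))).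
      intros j; apply (continuous_mult (fun _ => y ^ j)); [apply continuous_const|].
      apply (continuous_mult (fun _ => h N x (S (0 + j)) y)); [apply continuous_const|].
      apply continuous_h_mu; lra. }
    apply Hc, (open_gt 0); unfold sum.
    destruct N as [|M]; [lia|]; rewrite sum_lt_S_l.
    apply Rplus_lt_le_0_compat.
    - simpl; nra.
    - apply sum_lt_pos; intros i _; apply Rmult_le_pos; [apply pow_le; lra | apply Rle_0_sqr]. }
  generalize (filter_and _ _ (filter_and _ _ Hloc Hsame) (filter_and _ _ Hsum (locally_lt _ _ Hx))).
  apply filter_imp; intros t [[H1 H2] [H3 H4]].
  assert (HW := wronskian_sum N x t 0 N y ltac:(lra) ltac:(lra)).
  fold (sum t) in HW; unfold wronskian at 1 in HW; rewrite E in HW; simpl (0 + N)%nat in HW.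
  pose proof (wronskian_tail_sign N x t y ltac:(lra) Hx H4) as HT.
  assert (HyN : 0 < y ^ N) by (apply pow_lt; assumption).
  assert (Ht1 : h N t 1 y <> 0) by (intros E'; rewrite E' in H2; lra).
  assert (Hcount : forall u, node_count N u y =
    (sign_change (h N u 0 y) (h N u 1 y) + sign_changes (fun i => h N u i y) 1 (N - 1))%nat).
  { intros u; unfold node_count; destruct N as [|M]; [lia|].
    simpl; rewrite Nat.sub_0_r; reflexivity. }
  rewrite !Hcount, H1, E, (sign_change_0 0 (h N x 1 y)) by (auto; lra).
  split; intros Hlt.
  - rewrite sign_change_1; [reflexivity|].
    assert (0 <= wronskian N x t N y) by nra.
    assert (0 < (t - x) * sum t) by (apply Rmult_lt_0_compat; lra).
    assert (h N x 1 y * h N t 0 y < 0) by nra.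
    assert ((h N t 0 y * h N t 1 y) * (h N x 1 y * h N x 1 y) < 0) by nra.
    nra.
  - rewrite sign_change_0; [reflexivity|assumption|].
    assert (wronskian N x t N y <= 0) by nra.
    assert (0 < (x - t) * sum t) by (apply Rmult_lt_0_compat; lra).
    assert (0 < h N x 1 y * h N t 0 y) by nra.
    assert (0 < (h N t 0 y * h N t 1 y) * (h N x 1 y * h N x 1 y)) by nra.
    nra.
Qed.

(** * Euler's product for the sine *)

Fixpoint prod_lt (f : nat -> R) (k : nat) : R :=
  match k with O => 1 | S j => prod_lt f j * f j end.

(** Wallis integrals with a frequency: the quotient of [wallis 0 (2 * m)] by [wallis d (2 * m)]
    links the sine to the [m]-th partial product. *)
Definition wallis (d : R) (n : nat) : R := RInt (fun t => cos (2 * d * t) * cos t ^ n) 0 (PI / 2).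

Lemma continuous_wallis (d : R) (n : nat) (t : R) :
  continuous (fun t => cos (2 * d * t) * cos t ^ n) t.
Proof. apply (ex_derive_continuous (fun t => cos (2 * d * t) * cos t ^ n)); auto_derive; exact I. Qed.

Lemma is_RInt_wallis (d : R) (n : nat) :
  is_RInt (fun t => cos (2 * d * t) * cos t ^ n) 0 (PI / 2) (wallis d n).
Proof.
  apply (RInt_correct (fun t => cos (2 * d * t) * cos t ^ n)), ex_RInt_continuous.
  intros; apply continuous_wallis.
Qed.

(* Integration of the derivative of
   [n cos (2 d t) cos t ^ (n - 1) sin t - 2 d sin (2 d t) cos t ^ n] for [n = m + 2]. *)
Lemma wallis_rec (d : R) (m : nat) :
  ((INR m + 2) ^ 2 - 4 * d ^ 2) * wallis d (S (S m)) =
  (INR m + 2) * (INR m + 1) * wallis d m.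
Proof.
  set (F := fun t => (INR m + 2) * cos (2 * d * t) * cos t ^ S m * sin t
                     - 2 * d * sin (2 * d * t) * cos t ^ S (S m)).
  set (dF := fun t => ((INR m + 2) ^ 2 - 4 * d ^ 2) * (cos (2 * d * t) * cos t ^ S (S m))
                      - (INR m + 2) * (INR m + 1) * (cos (2 * d * t) * cos t ^ m)).
  assert (H1 : is_RInt dF 0 (PI / 2) (F (PI / 2) - F 0)).
  { apply (is_RInt_derive F dF).
    - intros t _; unfold F, dF.
      evar_last.
      + auto_derive; [exact I | reflexivity].
      + change (match m with O => 1 | S _ => INR m + 1 end) with (INR (S m)).
        change (Init.Nat.pred (S m)) with m.
        rewrite S_INR; simpl (cos t ^ S (S m)); simpl (cos t ^ S m).
        generalize (cos t ^ m); intros X.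
        pose proof (sin2_cos2 t) as E; unfold Rsqr in E.
        assert (E' : sin t * sin t = 1 - cos t * cos t) by lra.
        revert E'; generalize (sin t), (cos t), (sin (2 * d * t)), (cos (2 * d * t)).
        intros a b e f E'; simpl; ring [E'].
    - intros t _; unfold dF.
      apply (ex_derive_continuous (fun t => ((INR m + 2) ^ 2 - 4 * d ^ 2) * (cos (2 * d * t) * cos t ^ S (S m))
                      - (INR m + 2) * (INR m + 1) * (cos (2 * d * t) * cos t ^ m))); auto_derive; exact I. }
  assert (H2 : is_RInt dF 0 (PI / 2)
     (((INR m + 2) ^ 2 - 4 * d ^ 2) * wallis d (S (S m)) - (INR m + 2) * (INR m + 1) * wallis d m)).
  { unfold dF.
    apply (is_RInt_minus (fun t => ((INR m + 2) ^ 2 - 4 * d ^ 2) * (cos (2 * d * t) * cos t ^ S (S m)))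
             (fun t => (INR m + 2) * (INR m + 1) * (cos (2 * d * t) * cos t ^ m)));
      apply (is_RInt_scal (V := R_NormedModule)); apply is_RInt_wallis. }
  pose proof (is_RInt_unique _ _ _ _ H1) as E1; rewrite (is_RInt_unique _ _ _ _ H2) in E1.
  unfold F in E1; rewrite cos_PI2, !Rmult_0_r, sin_0, !pow_i in E1 by lia.
  lra.
Qed.

Lemma wallis_0 (d : R) : d <> 0 -> wallis d 0 = sin (PI * d) / (2 * d).
Proof.
  intros Hd; unfold wallis; apply is_RInt_unique.
  replace (sin (PI * d) / (2 * d))
    with (minus ((fun t => sin (2 * d * t) / (2 * d)) (PI / 2)) ((fun t => sin (2 * d * t) / (2 * d)) 0)).
  - apply (is_RInt_derive (fun t => sin (2 * d * t) / (2 * d))).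
    + intros t _; auto_derive; [exact I | simpl; field; assumption].
    + intros t _; apply (continuous_wallis d 0).
  - unfold minus, plus, opp; simpl; rewrite Rmult_0_r, sin_0.
    replace (2 * d * (PI / 2)) with (PI * d) by field; field; assumption.
Qed.

Lemma wallis_0_0 : wallis 0 0 = PI / 2.
Proof.
  unfold wallis; rewrite (RInt_ext _ (fun _ => 1)).
  - rewrite RInt_const; unfold scal; simpl; unfold mult; simpl; ring.
  - intros t _; replace (2 * 0 * t) with 0 by ring; rewrite cos_0; simpl; ring.
Qed.

(** The recursion gives the exact identity [sin (PI d) * wallis 0 (2 m) = PI d * P m * wallis d (2
    m)]. Since cosine is at most 1, [wallis d] is at most [wallis 0], so each partial product is an
    upper bound and no limit is taken. *)
Lemma sin_PI_le_prod (d : R) (m : nat) :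
  0 < d <= 1 -> sin (PI * d) <= PI * d * prod_lt (fun i => 1 - (d / INR (S i)) ^ 2) m.
Proof.
  intros Hd; set (P := prod_lt (fun i => 1 - (d / INR (S i)) ^ 2)).
  pose proof PI_RGT_0 as Hpi.
  assert (Hm : forall k : nat, INR (2 * k) = 2 * INR k) by (intros; rewrite mult_INR; reflexivity).
  assert (HB : 0 < wallis 0 (2 * m)).
  { induction m as [|k IH]; [simpl; rewrite wallis_0_0; lra|].
    replace (2 * S k)%nat with (S (S (2 * k))) by lia.
    pose proof (wallis_rec 0 (2 * k)) as E; rewrite Hm in E; pose proof (pos_INR k).
    assert (0 < (2 * INR k + 2) * (2 * INR k + 1) * wallis 0 (2 * k))
      by (repeat apply Rmult_lt_0_compat; lra).
    apply (Rmult_lt_reg_l ((2 * INR k + 2) ^ 2)); [apply pow_lt; lra|]; lra. }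
  assert (Hle : wallis d (2 * m) <= wallis 0 (2 * m)).
  { apply RInt_le; [lra | eexists; apply is_RInt_wallis | eexists; apply is_RInt_wallis |].
    intros t _; rewrite pow_mult, Rmult_0_r, Rmult_0_l, cos_0.
    apply Rmult_le_compat_r; [apply pow_le, pow2_ge_0 | apply COS_bound]. }
  assert (HP : 0 <= P m).
  { clear HB Hle; induction m as [|k IH]; [unfold P; simpl; lra|].
    change (P (S k)) with (P k * (1 - (d / INR (S k)) ^ 2)).
    apply Rmult_le_pos; [exact IH|].
    pose proof (pos_INR k); rewrite S_INR.
    assert (0 <= d / (INR k + 1) <= 1).
    { split; [apply Rdiv_le_0_compat; lra|].
      apply Rmult_le_reg_r with (INR k + 1); [lra|].
      unfold Rdiv; rewrite Rmult_assoc, Rinv_l by lra; lra. }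
    nra. }
  assert (E : sin (PI * d) * wallis 0 (2 * m) = PI * d * P m * wallis d (2 * m)).
  { clear HB Hle HP; induction m as [|k IH].
    - unfold P; simpl; rewrite wallis_0_0, wallis_0 by lra; field; lra.
    - replace (2 * S k)%nat with (S (S (2 * k))) by lia.
      pose proof (wallis_rec 0 (2 * k)) as E0; pose proof (wallis_rec d (2 * k)) as Ed.
      rewrite Hm in E0, Ed; pose proof (pos_INR k).
      change (P (S k)) with (P k * (1 - (d / INR (S k)) ^ 2)); rewrite S_INR.
      apply (Rmult_eq_reg_l ((2 * INR k + 2) ^ 2)); [|apply Rgt_not_eq, pow_lt; lra].
      replace ((2 * INR k + 2) ^ 2 * (sin (PI * d) * wallis 0 (S (S (2 * k)))))
        with (sin (PI * d) * (((2 * INR k + 2) ^ 2 - 4 * 0 ^ 2) * wallis 0 (S (S (2 * k))))) by ring.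
      rewrite E0.
      replace ((2 * INR k + 2) ^ 2 * (PI * d * (P k * (1 - (d / (INR k + 1)) ^ 2)) * wallis d (S (S (2 * k)))))
        with (PI * d * P k * (((2 * INR k + 2) ^ 2 - 4 * d ^ 2) * wallis d (S (S (2 * k)))))
        by (field; lra).
      rewrite Ed.
      replace (sin (PI * d) * ((2 * INR k + 2) * (2 * INR k + 1) * wallis 0 (2 * k)))
        with ((2 * INR k + 2) * (2 * INR k + 1) * (sin (PI * d) * wallis 0 (2 * k))) by ring.
      rewrite IH; ring. }
  fold (P m).
  apply (Rmult_le_reg_r (wallis 0 (2 * m))); [assumption|].
  rewrite E; apply Rmult_le_compat_l; [|assumption].
  apply Rmult_le_pos; [apply Rmult_le_pos; lra | assumption].
Qed.

(** From [sin x >= x - x ^ 3 / 6] and [x ^ 2 <= 282 / 100] one gets the constant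
    [1 - 282 / 600 = 53 / 100]. *)
Lemma sin_PI_ge (d : R) : 0 <= d <= 1 / 2 -> 53 / 100 * (PI * d) <= sin (PI * d).
Proof.
  intros Hd; pose proof PI_RGT_0 as Hpi.
  assert (HPI : PI <= 335 / 100).
  { destruct (PI_ineq 2) as [_ H]; unfold tg_alt, PI_tg in H; simpl in H; lra. }
  set (x := PI * d).
  assert (Hx : 0 <= x <= 1675 / 1000) by (unfold x; nra).
  destruct (SIN x) as [H _]; [lra | unfold x; nra |].
  unfold sin_lb, sin_approx, sin_term in H; simpl in H.
  assert (0 <= x ^ 5 * (42 - x ^ 2)) by (apply Rmult_le_pos; [apply pow_le; lra | nra]).
  assert (x ^ 2 <= 282 / 100) by nra.
  assert (0 <= x * (282 / 100 - x ^ 2)) by (apply Rmult_le_pos; lra).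
  simpl in *; lra.
Qed.

(** * Nonvanishing of the boundary value *)

Definition harmonic (m : nat) : R := sum_lt (fun i => / INR (S i)) m.

Lemma harmonic_S (m : nat) : harmonic (S m) = harmonic m + / (INR m + 1).
Proof. rewrite <- S_INR; reflexivity. Qed.

Lemma harmonic_pos (m : nat) : (1 <= m)%nat -> 1 <= harmonic m.
Proof.
  induction 1 as [|m Hm IH]; [unfold harmonic; simpl; lra|].
  rewrite harmonic_S; pose proof (pos_INR m).
  assert (0 < / (INR m + 1)) by (apply Rinv_0_lt_compat; lra); lra.
Qed.

Lemma exp_INR_mult (n : nat) (u : R) : exp (INR n * u) = exp u ^ n.
Proof.
  induction n as [|n IH]; [simpl; rewrite Rmult_0_l; apply exp_0|].
  rewrite S_INR, Rmult_plus_distr_r, Rmult_1_l, exp_plus, IH; simpl; ring.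
Qed.

Lemma pow_one_plus_le_exp (n : nat) (u : R) : -1 <= u -> (1 + u) ^ n <= exp (INR n * u).
Proof.
  intros Hu; rewrite exp_INR_mult; apply pow_incr; split; [lra | apply exp_ineq1_le].
Qed.

(** The square of [exp (3 / 2)] is [exp 1 ^ 3 <= 27], and [27 < 5.2 ^ 2 = 27.04]. *)
Lemma exp_3_2_le : exp (3 / 2) <= 52 / 10.
Proof.
  pose proof (exp_INR_mult 2 (3 / 2)) as E2; pose proof (exp_INR_mult 3 1) as E3.
  replace (INR 3 * 1) with (INR 2 * (3 / 2)) in E3 by (simpl; field).
  rewrite E2 in E3; pose proof exp_le_3; pose proof (exp_pos 1); pose proof (exp_pos (3 / 2)).
  assert (exp 1 ^ 3 <= 3 ^ 3) by (apply pow_incr; lra); nra.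
Qed.

(** The case [m = 4] is the tight one: with [1 / 2] in place of [53 / 100] it would fail. *)
Lemma harmonic_factorial_base (m : nat) : (1 <= m <= 6)%nat ->
  ((INR m - 1 / 2) / 2) ^ m * INR m * harmonic m ^ S m
    <= 53 / 100 * INR (fact (S m)) * INR (fact m).
Proof.
  intros Hm.
  assert (C : m = 1%nat \/ m = 2%nat \/ m = 3%nat \/ m = 4%nat \/ m = 5%nat \/ m = 6%nat) by lia.
  destruct C as [->|[->|[->|[->|[->| ->]]]]]; unfold harmonic; simpl; lra.
Qed.

(* For [m >= 6] the quotient of consecutive left-hand sides is at most
   [exp (3 / 2) (m + 1 / 2) (m + 1) H_(m+1) / (2 m) <= (m + 1) (m + 2)]. *)
Lemma harmonic_factorial_step (m : nat) :
  6 <= INR m -> 245 / 100 <= harmonic m -> harmonic (S m) <= 325 / 1000 * (INR m + 2) ->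
  ((INR (S m) - 1 / 2) / 2) ^ S m * INR (S m) * harmonic (S m) ^ S (S m)
  <= (((INR m - 1 / 2) / 2) ^ m * INR m * harmonic m ^ S m) * ((INR m + 2) * (INR m + 1)).
Proof.
  intros Hm HH HS1.
  set (M := INR m) in *; set (H := harmonic m) in *.
  assert (HM : INR (S m) = M + 1) by apply S_INR.
  assert (EH : harmonic (S m) = H * (1 + / ((M + 1) * H))).
  { rewrite harmonic_S; fold M H; field; split; lra. }
  assert (EM : (M + 1 - 1 / 2) / 2 = ((M - 1 / 2) / 2) * (1 + / (M - 1 / 2))) by (field; lra).
  set (u := / (M - 1 / 2)) in *; set (v := / ((M + 1) * H)) in *.
  assert (Hu : 0 < u) by (apply Rinv_0_lt_compat; lra).
  assert (Hv : 0 < v) by (apply Rinv_0_lt_compat; nra).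
  (* The exponents are at most [12 / 11] and [100 / 245], whose sum lies just below [3 / 2]. *)
  assert (Huv : (1 + u) ^ m * (1 + v) ^ S m <= 52 / 10).
  { apply Rle_trans with (exp (M * u) * exp (INR (S m) * v)).
    - apply Rmult_le_compat; try (apply pow_le; lra); apply pow_one_plus_le_exp; lra.
    - rewrite <- exp_plus; eapply Rle_trans; [|apply exp_3_2_le].
      assert (M * u <= 12 / 11).
      { unfold u; apply Rmult_le_reg_r with (M - 1 / 2); [lra|].
        rewrite Rmult_assoc, Rinv_l by lra; lra. }
      assert (INR (S m) * v <= 100 / 245).
      { rewrite HM; unfold v; rewrite Rinv_mult, <- Rmult_assoc, Rinv_r, Rmult_1_l by lra.
        apply Rmult_le_reg_r with H; [lra|]; rewrite Rinv_l by lra; lra. }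
      destruct (Rle_lt_or_eq_dec (M * u + INR (S m) * v) (3 / 2)) as [Hlt|Heq]; [lra| |].
      + left; apply exp_increasing; exact Hlt.
      + rewrite Heq; lra. }
  change (harmonic (S m) ^ S (S m)) with (harmonic (S m) * harmonic (S m) ^ S m).
  rewrite EH at 2; rewrite HM, EM.
  change ((((M - 1 / 2) / 2) * (1 + u)) ^ S m)
    with (((M - 1 / 2) / 2) * (1 + u) * (((M - 1 / 2) / 2) * (1 + u)) ^ m).
  rewrite !Rpow_mult_distr.
  set (X := ((M - 1 / 2) / 2) ^ m) in *; set (Y := H ^ S m).
  set (U := (1 + u) ^ m) in *; set (V := (1 + v) ^ S m) in *.
  assert (HX : 0 < X) by (apply pow_lt; lra).
  assert (HY : 0 < Y) by (apply pow_lt; lra).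
  assert (HUV : 0 < U * V) by (apply Rmult_lt_0_compat; apply pow_lt; lra).
  assert (H1 : 0 < harmonic (S m)) by (pose proof (harmonic_pos (S m) ltac:(lia)); lra).
  replace ((M - 1 / 2) / 2 * (1 + u) * (X * U) * (M + 1) * (harmonic (S m) * (Y * V)))
    with (X * Y * (M + 1) * ((M - 1 / 2) / 2 * (1 + u) * harmonic (S m) * (U * V))) by ring.
  rewrite <- EM.
  replace (X * M * Y * ((M + 2) * (M + 1))) with (X * Y * (M + 1) * (M * (M + 2))) by ring.
  apply Rmult_le_compat_l; [apply Rmult_le_pos; [nra | lra]|].
  apply Rle_trans with ((M + 1 - 1 / 2) / 2 * (325 / 1000 * (M + 2)) * (52 / 10)).
  - apply Rmult_le_compat; [apply Rmult_le_pos; lra | lra | | exact Huv].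
    apply Rmult_le_compat_l; lra.
  - nra.
Qed.

Lemma harmonic_factorial_bound (m : nat) : (1 <= m)%nat ->
  ((INR m - 1 / 2) / 2) ^ m * INR m * harmonic m ^ S m
    <= 53 / 100 * INR (fact (S m)) * INR (fact m).
Proof.
  intros Hm.
  destruct (Nat.le_gt_cases m 6) as [H6|H6]; [apply harmonic_factorial_base; lia|].
  (* Here [245 / 100] is exactly [harmonic 6], and [harmonic 7] is just below [325 / 1000 * 8]; each
     later increment is at most [1 / 8]. *)
  assert (H : forall k, (245 / 100 <= harmonic (6 + k) /\
      harmonic (S (6 + k)) <= 325 / 1000 * (INR (6 + k) + 2)) /\
    ((INR (6 + k) - 1 / 2) / 2) ^ (6 + k) * INR (6 + k) * harmonic (6 + k) ^ S (6 + k)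
      <= 53 / 100 * INR (fact (S (6 + k))) * INR (fact (6 + k))).
  { induction k as [|k [[IH1 IH2] IH3]].
    - split; [unfold harmonic; simpl; lra | apply harmonic_factorial_base; lia].
    - rewrite Nat.add_succ_r; set (p := (6 + k)%nat) in *.
      assert (Hp : 6 <= INR p) by (unfold p; rewrite plus_INR; simpl; pose proof (pos_INR k); lra).
      split; [split|].
      + rewrite harmonic_S; assert (0 < / (INR p + 1)) by (apply Rinv_0_lt_compat; lra); lra.
      + rewrite harmonic_S, S_INR.
        assert (/ (INR p + 1 + 1) <= / 8) by (apply Rinv_le_contravar; lra); lra.
      + eapply Rle_trans; [apply harmonic_factorial_step; assumption|].
        rewrite (fact_simpl (S p)), (mult_INR (S (S p))), (fact_simpl p) at 1.
        rewrite (fact_simpl p), (mult_INR (S p)), !S_INR.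
        rewrite (fact_simpl p), mult_INR, S_INR in IH3.
        eapply Rle_trans; [apply Rmult_le_compat_r; [nra | exact IH3]|].
        right; rewrite ?mult_INR, ?S_INR; ring. }
  replace m with (6 + (m - 6))%nat by lia; apply H.
Qed.

(** The threshold of [head_sum_ge] satisfies the hypothesis of [head_sum_dominates]. One factor [d]
    is kept to match the sine; in the other [m] factors [d * (m - d)] is replaced by its largest
    value, at [d = 1 / 2]. *)
Lemma threshold_bound (m : nat) (d : R) :
  (1 <= m)%nat -> 0 < d <= 1 / 2 ->
  (d * (INR m - d) * harmonic m) ^ S m
    <= sin (PI * d) / PI * INR (fact (S m)) * INR (fact m).
Proof.
  intros Hm Hd.
  assert (HM : 1 <= INR m) by (apply (le_INR 1); assumption).
  pose proof (harmonic_pos m Hm) as HH.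
  apply Rle_trans with (d * (53 / 100 * INR (fact (S m)) * INR (fact m))).
  - eapply Rle_trans; [|apply Rmult_le_compat_l; [lra | apply harmonic_factorial_bound; assumption]].
    rewrite Rpow_mult_distr, <- !Rmult_assoc.
    apply Rmult_le_compat_r; [apply pow_le; lra|].
    change ((d * (INR m - d)) ^ S m) with (d * (INR m - d) * (d * (INR m - d)) ^ m).
    assert ((d * (INR m - d)) ^ m <= ((INR m - 1 / 2) / 2) ^ m) by (apply pow_incr; nra).
    assert (0 <= (d * (INR m - d)) ^ m) by (apply pow_le; nra).
    rewrite Rmult_assoc, (Rmult_assoc d), (Rmult_comm _ (INR m)).
    apply Rmult_le_compat_l; [lra|]; apply Rmult_le_compat; lra.
  - pose proof (sin_PI_ge d ltac:(lra)) as Hs; pose proof PI_RGT_0.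
    replace (d * (53 / 100 * INR (fact (S m)) * INR (fact m)))
      with (53 / 100 * d * INR (fact (S m)) * INR (fact m)) by ring.
    apply Rmult_le_compat_r; [apply pos_INR|]; apply Rmult_le_compat_r; [apply pos_INR|].
    apply Rmult_le_reg_r with PI; [assumption|].
    unfold Rdiv at 2; rewrite Rmult_assoc, (Rmult_assoc _ (/ PI)), Rinv_l by lra; lra.
Qed.

(** * Lower bounds for the Taylor head *)

Definition trunc_exp (m : nat) (x : R) : R := sum_lt (fun k => x ^ k / INR (fact k)) (S m).

Lemma trunc_exp_S (m : nat) (x : R) :
  trunc_exp (S m) x = trunc_exp m x + x ^ S m / INR (fact (S m)).
Proof. reflexivity. Qed.

Lemma trunc_exp_le (m : nat) (x z : R) : 0 <= x <= z -> trunc_exp m x <= trunc_exp m z.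
Proof.
  intros H; apply sum_lt_le; intros i _.
  apply Rmult_le_compat_r; [left; apply Rinv_0_lt_compat, INR_fact_lt_0|].
  apply pow_incr; exact H.
Qed.

Lemma pow_tangent (k : nat) (x u : R) : 0 <= x -> 0 <= u ->
  x ^ S k + INR (S k) * u * x ^ k <= (x + u) ^ S k.
Proof.
  intros Hx Hu; induction k as [|k IH]; [simpl; lra|].
  change ((x + u) ^ S (S k)) with ((x + u) * (x + u) ^ S k).
  apply Rle_trans with ((x + u) * (x ^ S k + INR (S k) * u * x ^ k)).
  - rewrite (S_INR (S k)); simpl (x ^ S (S k)); simpl (x ^ S k).
    assert (0 <= x ^ k) by (apply pow_le; assumption).
    assert (0 <= INR (S k) * (u * u) * x ^ k)
      by (apply Rmult_le_pos; [apply Rmult_le_pos; [apply pos_INR | nra] | assumption]).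
    nra.
  - apply Rmult_le_compat_l; [lra | exact IH].
Qed.

Lemma trunc_exp_add (m : nat) (x u : R) : 0 <= x -> 0 <= u ->
  trunc_exp m x * (1 + u) <= trunc_exp (S m) (x + u).
Proof.
  intros Hx Hu.
  assert (H : forall k, trunc_exp (S k) x + u * trunc_exp k x <= trunc_exp (S k) (x + u)).
  { induction k as [|k IH]; [unfold trunc_exp; simpl; lra|].
    rewrite (trunc_exp_S (S k)), (trunc_exp_S (S k) (x + u)), (trunc_exp_S k x) at 1.
    rewrite (trunc_exp_S k x) in IH.
    pose proof (pow_tangent (S k) x u Hx Hu) as HT.
    apply (Rmult_le_compat_r (/ INR (fact (S (S k))))) in HT;
      [|left; apply Rinv_0_lt_compat, INR_fact_lt_0].
    rewrite Rmult_plus_distr_r in HT.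
    replace (INR (S (S k)) * u * x ^ S k * / INR (fact (S (S k))))
      with (u * (x ^ S k / INR (fact (S k)))) in HT.
    - rewrite (trunc_exp_S k x); unfold Rdiv in *; lra.
    - rewrite (fact_simpl (S k)), mult_INR; pose proof (INR_fact_neq_0 (S k)).
      pose proof (pos_INR (S k)); rewrite (S_INR (S k)); field; split; lra. }
  specialize (H m); rewrite trunc_exp_S in H.
  assert (0 <= x ^ S m / INR (fact (S m)))
    by (apply Rdiv_le_0_compat; [apply pow_le; assumption | apply INR_fact_lt_0]).
  lra.
Qed.

(** A product of [m] factors has degree [m] in [d], and its [k]-th elementary symmetric sum is at
    most the [k]-th power of the sum over [k!]. Truncation at degree [m] is essential, as the head
    has no further terms. *)
Lemma prod_le_trunc_exp (m : nat) (d : R) : 0 <= d ->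
  prod_lt (fun i => 1 + d / INR (S i)) m <= trunc_exp m (d * harmonic m).
Proof.
  intros Hd; induction m as [|m IH]; [unfold trunc_exp; simpl; lra|].
  rewrite harmonic_S, <- S_INR, Rmult_plus_distr_l.
  assert (0 < / INR (S m)) by (apply Rinv_0_lt_compat, lt_0_INR; lia).
  assert (0 <= harmonic m).
  { apply sum_lt_pos; intros i _; left; apply Rinv_0_lt_compat, lt_0_INR; lia. }
  assert (Hdm : 0 <= d * / INR (S m)) by (apply Rmult_le_pos; lra).
  eapply Rle_trans; [|apply trunc_exp_add; [apply Rmult_le_pos; assumption | exact Hdm]].
  apply Rmult_le_compat_r; [|exact IH]; unfold Rdiv in *; lra.
Qed.

Lemma rising_eq_prod (m : nat) (d : R) :
  rising (1 - d) m = INR (fact m) * prod_lt (fun i => 1 - d / INR (S i)) m.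
Proof.
  induction m as [|m IH]; [simpl; ring|].
  rewrite fact_simpl, mult_INR; cbn [rising prod_lt]; rewrite IH.
  pose proof (pos_INR m); rewrite !S_INR; field; lra.
Qed.

(** Each of the [k] factors split off is at most the last one, [m - d]. *)
Lemma rising_le (m k : nat) (d : R) : d < 1 -> (k <= m)%nat ->
  rising (1 - d) m <= rising (1 - d) (m - k) * (INR m - d) ^ k.
Proof.
  intros Hd; induction k as [|k IH]; intros Hk; [rewrite Nat.sub_0_r; simpl; lra|].
  eapply Rle_trans; [apply IH; lia|].
  replace (m - k)%nat with (S (m - S k)) by lia.
  cbn [rising pow].
  assert (0 < rising (1 - d) (m - S k)) by (apply rising_pos; lra).
  rewrite minus_INR, S_INR by assumption; pose proof (pos_INR k).
  assert (INR (S k) <= INR m) by (apply le_INR; assumption); rewrite S_INR in *.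
  rewrite Rmult_assoc; apply Rmult_le_compat_l; [lra|].
  apply Rmult_le_compat_r; [apply pow_le; lra | lra].
Qed.

(* For [mu = m + 1 - d], the first [m + 1] Taylor terms of [h_0] at [y = 0] all have
   the same sign; [head_sum] is their sum up to the factor [(-1) ^ m * q_m]. *)
Definition head_sum (m : nat) (d y : R) : R :=
  sum_lt (fun k => y ^ k / INR (fact k) * rising (1 - d) (m - k)) (S m).

(** Factoring [1 - a ^ 2] as [(1 - a) * (1 + a)] turns the left side into [rising (1 - d) m] times
    the product of the [1 + d / i]. By [rising_le] the head is at least that same factor times the
    truncated exponential at [y / (m - d)], which the hypothesis places beyond [d * harmonic m]. *)
Lemma head_sum_ge (m : nat) (d y : R) : (1 <= m)%nat -> 0 < d < 1 ->
  d * (INR m - d) * harmonic m <= y ->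
  INR (fact m) * prod_lt (fun i => 1 - (d / INR (S i)) ^ 2) m <= head_sum m d y.
Proof.
  intros Hm Hd Hy.
  assert (HM : 1 <= INR m) by (apply (le_INR 1); assumption).
  pose proof (harmonic_pos m Hm) as HH.
  assert (Hy0 : 0 <= y) by (assert (0 < d * (INR m - d)) by (apply Rmult_lt_0_compat; lra); nra).
  assert (E : INR (fact m) * prod_lt (fun i => 1 - (d / INR (S i)) ^ 2) m =
    rising (1 - d) m * prod_lt (fun i => 1 + d / INR (S i)) m).
  { rewrite rising_eq_prod, Rmult_assoc; f_equal.
    clear; induction m as [|m IH]; cbn [prod_lt]; [ring | rewrite IH; ring]. }
  rewrite E.
  set (z := y / (INR m - d)).
  apply Rle_trans with (rising (1 - d) m * trunc_exp m z).
  - apply Rmult_le_compat_l; [left; apply rising_pos; lra|].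
    eapply Rle_trans; [apply prod_le_trunc_exp; lra|].
    apply trunc_exp_le; split; [nra|].
    unfold z; apply Rmult_le_reg_r with (INR m - d); [lra|].
    unfold Rdiv; rewrite (Rmult_assoc y), Rinv_l by lra; lra.
  - unfold trunc_exp, head_sum; rewrite <- sum_lt_scal; apply sum_lt_le; intros k Hk.
    assert (Hf : 0 < / INR (fact k)) by (apply Rinv_0_lt_compat, INR_fact_lt_0).
    assert (Hz : 0 <= z ^ k) by (apply pow_le, Rdiv_le_0_compat; lra).
    assert (Hyz : y ^ k = z ^ k * (INR m - d) ^ k).
    { rewrite <- Rpow_mult_distr; f_equal; unfold z; field; lra. }
    rewrite Hyz; unfold Rdiv.
    replace (rising (1 - d) m * (z ^ k * / INR (fact k)))
      with (z ^ k * / INR (fact k) * rising (1 - d) m) by ring.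
    replace (z ^ k * (INR m - d) ^ k * / INR (fact k) * rising (1 - d) (m - k))
      with (z ^ k * / INR (fact k) * (rising (1 - d) (m - k) * (INR m - d) ^ k)) by ring.
    apply Rmult_le_compat_l; [apply Rmult_le_pos; lra|].
    apply rising_le; [lra | lia].
Qed.

(** The head has degree [m] in [y], so it shrinks at worst like [r ^ m], while the remainder bound
    shrinks like [r ^ S m]. *)
Lemma head_sum_scale (m : nat) (d y r : R) : d < 1 -> 0 <= y -> 0 <= r <= 1 ->
  r ^ m * head_sum m d y <= head_sum m d (r * y).
Proof.
  intros Hd Hy Hr; unfold head_sum; rewrite <- sum_lt_scal; apply sum_lt_le; intros k Hk.
  rewrite Rpow_mult_distr; unfold Rdiv.
  rewrite <- !Rmult_assoc; apply Rmult_le_compat_r; [left; apply rising_pos; lra|].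
  apply Rmult_le_compat_r; [left; apply Rinv_0_lt_compat, INR_fact_lt_0|].
  apply Rmult_le_compat_r; [apply pow_le; assumption|].
  replace m with (k + (m - k))%nat by lia; rewrite pow_add.
  assert (0 <= r ^ k) by (apply pow_le; lra).
  assert (r ^ (m - k) <= 1) by (rewrite <- (pow1 (m - k)); apply pow_incr; lra).
  nra.
Qed.

(* Above the threshold of [threshold_bound] this is [head_sum_ge]; below it, the
   left-hand side decreases faster than the right-hand side. *)
Lemma head_sum_dominates (m : nat) (d y : R) : 0 < d <= 1 / 2 -> 0 <= y ->
  y ^ S m <= sin (PI * d) / PI * INR (fact (S m)) * INR (fact m) ->
  y ^ S m / INR (fact (S m)) < d * head_sum m d y.
Proof.
  intros Hd Hy Hys.
  pose proof PI_RGT_0 as Hpi.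
  pose proof (INR_fact_lt_0 m) as Hf; pose proof (INR_fact_lt_0 (S m)) as HfS.
  (* Applying Euler's product with [S m] factors and dropping the last one makes the inequality
     strict. *)
  assert (Hsig : sin (PI * d) / PI < d * prod_lt (fun i => 1 - (d / INR (S i)) ^ 2) m).
  { pose proof (sin_PI_le_prod d (S m) ltac:(lra)) as HS; cbn [prod_lt] in HS.
    assert (HP : 0 < prod_lt (fun i => 1 - (d / INR (S i)) ^ 2) m).
    { clear - Hd; induction m as [|m IH]; cbn [prod_lt]; [lra|].
      apply Rmult_lt_0_compat; [exact IH|].
      assert (1 <= INR (S m)) by (apply (le_INR 1); lia).
      assert (0 < d / INR (S m) < 1).
      { split; [apply Rdiv_lt_0_compat; lra|].
        apply Rmult_lt_reg_r with (INR (S m)); [lra|].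
        unfold Rdiv; rewrite Rmult_assoc, Rinv_l by lra; lra. }
      nra. }
    assert (0 < (d / INR (S m)) ^ 2)
      by (apply pow_lt, Rdiv_lt_0_compat; [lra | apply lt_0_INR; lia]).
    apply Rmult_lt_reg_r with PI; [assumption|].
    unfold Rdiv at 1; rewrite Rmult_assoc, Rinv_l, Rmult_1_r by lra.
    eapply Rle_lt_trans; [exact HS|].
    assert (0 < PI * d) by nra.
    assert (0 < PI * d * prod_lt (fun i => 1 - (d / INR (S i)) ^ 2) m)
      by (apply Rmult_lt_0_compat; assumption).
    nra. }
  assert (Hbig : forall z, 0 <= z -> m = 0%nat \/ d * (INR m - d) * harmonic m <= z ->
     z ^ S m <= sin (PI * d) / PI * INR (fact (S m)) * INR (fact m) ->
     z ^ S m / INR (fact (S m)) < d * head_sum m d z).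
  { intros z Hz Hcase Hzs.
    apply Rle_lt_trans with (sin (PI * d) / PI * INR (fact m)).
    - apply Rmult_le_reg_r with (INR (fact (S m))); [assumption|].
      unfold Rdiv at 1; rewrite Rmult_assoc, Rinv_l by lra; lra.
    - apply Rlt_le_trans with (d * prod_lt (fun i => 1 - (d / INR (S i)) ^ 2) m * INR (fact m)).
      + apply Rmult_lt_compat_r; assumption.
      + rewrite Rmult_assoc; apply Rmult_le_compat_l; [lra|].
        destruct (Nat.eq_dec m 0) as [->|Hm0].
        * unfold head_sum; simpl; lra.
        * rewrite Rmult_comm; apply head_sum_ge; [lia | lra | tauto]. }
  destruct (Nat.eq_dec m 0) as [Hm0|Hm0]; [apply Hbig; auto|].
  set (ys := d * (INR m - d) * harmonic m).
  destruct (Rle_lt_dec ys y) as [Hle|Hlt]; [apply Hbig; auto|].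
  assert (Hys0 : 0 < ys) by lra.
  assert (Hstar := Hbig ys ltac:(lra) ltac:(right; unfold ys; lra)
                     (threshold_bound m d ltac:(lia) Hd)).
  destruct (Req_EM_T y 0) as [->|Hy0].
  - rewrite pow_i by lia; unfold Rdiv; rewrite Rmult_0_l.
    apply Rmult_lt_0_compat; [lra|].
    unfold head_sum; rewrite sum_lt_S_l.
    apply Rplus_lt_le_0_compat.
    + simpl pow; simpl fact; rewrite Nat.sub_0_r.
      assert (0 < rising (1 - d) m) by (apply rising_pos; lra); simpl; lra.
    + apply sum_lt_pos; intros i _; rewrite pow_i by lia; unfold Rdiv; lra.
  - set (r := y / ys).
    assert (Hr : 0 < r <= 1).
    { split; [apply Rdiv_lt_0_compat; lra|].
      unfold r; apply Rmult_le_reg_r with ys; [assumption|].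
      unfold Rdiv; rewrite Rmult_assoc, Rinv_l by lra; lra. }
    assert (Ey : y = r * ys) by (unfold r; field; lra).
    pose proof (head_sum_scale m d ys r ltac:(lra) ltac:(lra) ltac:(lra)) as Hsc.
    rewrite Ey; apply Rlt_le_trans with (r ^ m * (d * head_sum m d ys)).
    + rewrite Rpow_mult_distr; change (r ^ S m) with (r * r ^ m).
      assert (Hrm : 0 < r ^ m) by (apply pow_lt; lra).
      apply Rle_lt_trans with (r ^ m * (ys ^ S m / INR (fact (S m)))).
      * replace (r * r ^ m * ys ^ S m / INR (fact (S m)))
          with (r * (r ^ m * (ys ^ S m / INR (fact (S m))))) by (unfold Rdiv; ring).
        assert (0 < ys ^ S m / INR (fact (S m))) by (apply Rdiv_lt_0_compat; [apply pow_lt|]; assumption).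
        assert (0 < r ^ m * (ys ^ S m / INR (fact (S m)))) by (apply Rmult_lt_0_compat; assumption).
        nra.
      * apply Rmult_lt_compat_l; assumption.
    + nra.
Qed.

(** * The boundary value at [mu = s - d] *)

Lemma q_below (N m : nat) (d : R) (j : nat) : (j <= m)%nat -> (m <= N)%nat -> 0 < d ->
  q N (INR (S m) - d) (m - j) =
  (-1) ^ j * rising (1 - d) j * q N (INR (S m) - d) m.
Proof.
  intros Hj HN Hd; induction j as [|j IH]; [rewrite Nat.sub_0_r; simpl; ring|].
  apply le_INR in HN.
  rewrite q_rec by (rewrite S_INR; lra).
  replace (S (m - S j)) with (m - j)%nat by lia.
  (* The new factor is [-(j + 1 - d)]; the resulting alternation cancels the signs of the Taylor
     series in [h_0_nonzero]. *)
  rewrite IH by lia; rewrite minus_INR, !S_INR by assumption; cbn [rising pow]; ring.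
Qed.

(** Taylor's formula is cut where the order [n - mu] becomes positive: the remainder involves
    [h_(m+1)], of order [d], to which [h_abs_le] applies. The factor [d] in [head_sum_dominates] is
    the quotient of [q_m] by [q_(m+1)]. *)
Lemma h_0_nonzero (N m : nat) (d y : R) : (m < N)%nat -> 0 < d <= 1 / 2 -> 0 <= y ->
  y ^ S m <= sin (PI * d) / PI * INR (fact (S m)) * INR (fact m) ->
  h N (INR (S m) - d) 0 y <> 0.
Proof.
  intros HmN Hd Hy Hys E.
  assert (HN : INR (S m) <= INR N) by (apply le_INR; lia).
  set (mu := INR (S m) - d) in *.
  assert (Hq : 0 < q N mu (S m)) by (apply q_pos; unfold mu; rewrite ?S_INR in *; lra).
  assert (Hqm : q N mu m = d * q N mu (S m)).
  { rewrite q_rec by (unfold mu; lra); f_equal; unfold mu; rewrite S_INR; ring. }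
  pose proof (h_taylor N mu (S m) 0 y (q N mu (S m)) ltac:(unfold mu; lra) Hy) as HT.
  rewrite E in HT.
  assert (Htay : taylor N mu 0 (S m) y = (-1) ^ m * (q N mu m * head_sum m d y)).
  { unfold taylor, head_sum; rewrite <- !sum_lt_scal; apply sum_lt_ext; intros k Hk.
    simpl (0 + k)%nat.
    replace k with (m - (m - k))%nat at 2 by lia.
    unfold mu; rewrite q_below by (lia || lra); fold mu.
    assert (Es : (-1) ^ m = (-1) ^ k * (-1) ^ (m - k)) by (rewrite <- pow_add; f_equal; lia).
    rewrite Es; unfold Rdiv; ring. }
  rewrite Htay in HT.
  assert (HB : Rabs (0 - (-1) ^ m * (q N mu m * head_sum m d y))
               <= q N mu (S m) * (y ^ S m / INR (fact (S m)))).
  { apply HT; intros x Hx; rewrite <- (Rabs_pos_eq (q N mu (S m))) by lra.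
    apply h_abs_le; [unfold mu; lra | unfold mu; simpl (0 + S m)%nat; lra | lra]. }
  rewrite Rminus_0_l, Rabs_Ropp, Rabs_mult, pow_1_abs, Rmult_1_l in HB.
  pose proof (Rle_abs (q N mu m * head_sum m d y)).
  pose proof (head_sum_dominates m d y Hd Hy Hys).
  rewrite Hqm in *; nra.
Qed.

(** * Eigenvalues as zeros *)

(* The analogue of [J_(-m) = (-1) ^ m J_m] for Bessel functions of integer order. *)
Lemma h_reflection (N s : nat) (y : R) : INR s < INR N + 1 -> forall m, (m <= s)%nat ->
  h N (INR s) (s - m) y = (-1) ^ m * y ^ m * h N (INR s) (s + m) y.
Proof.
  intros HN.
  assert (H : forall m,
    ((m <= s)%nat -> h N (INR s) (s - m) y = (-1) ^ m * y ^ m * h N (INR s) (s + m) y) /\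
    ((S m <= s)%nat -> h N (INR s) (s - S m) y = (-1) ^ S m * y ^ S m * h N (INR s) (s + S m) y)).
  { induction m as [|m [IH1 IH2]].
    - split; intros Hm; [rewrite Nat.sub_0_r, Nat.add_0_r; simpl; ring|].
      rewrite h_rec by assumption; rewrite minus_INR by assumption.
      replace (S (s - 1)) with s by lia; rewrite Nat.add_1_r; simpl; ring.
    - split; [exact IH2|]; intros Hm.
      rewrite (h_rec N (INR s) (s - S (S m))) by assumption.
      replace (S (s - S (S m))) with (s - S m)%nat by lia.
      replace (S (s - S m)) with (s - m)%nat by lia.
      rewrite IH1, IH2 by lia; rewrite (h_rec N (INR s) (s + m)) by assumption.
      rewrite minus_INR, plus_INR, !S_INR, !Nat.add_succ_r by assumption; simpl; ring. }
  intros m; apply (H m).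
Qed.

(** The step from [s - m - 1] to [s - m] is paired with its mirror step from [s + m] to [s + m + 1].
    By reflection the two products of neighbours have opposite signs, so each of the [s] pairs holds
    at least one change; zeros are covered by the counting convention. *)
Lemma node_count_integer (N s : nat) (y : R) :
  0 < y -> INR s < INR N - 1 - 2 * y -> (2 * s <= N)%nat -> (s <= node_count N (INR s) y)%nat.
Proof.
  intros Hy Hs HN; set (a := fun n => h N (INR s) n y).
  assert (H : forall m, (m <= s)%nat -> (m <= sign_changes a (s - m) (2 * m))%nat).
  { induction m as [|m IH]; intros Hm; [lia|].
    replace (2 * S m)%nat with (S (2 * m + 1)) by lia.
    cbn [sign_changes]; rewrite sign_changes_app.
    replace (S (s - S m)) with (s - m)%nat by lia.
    replace (s - m + 2 * m)%nat with (s + m)%nat by lia.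
    cbn [sign_changes].
    specialize (IH ltac:(lia)).
    assert (Hone : (1 <= sign_change (a (s - S m)%nat) (a (s - m)%nat)
                         + sign_change (a (s + m)%nat) (a (S (s + m))))%nat); [|lia].
    unfold a; rewrite !h_reflection, Nat.add_succ_r by (lra || lia); fold a.
    fold (a (s + m)%nat) (a (S (s + m))).
    assert (HnZ := h_consecutive_zeros N (INR s) (s + m) y Hy Hs).
    fold (a (s + m)%nat) (a (S (s + m))) in HnZ.
    assert (Hym : 0 < y ^ m) by (apply pow_lt; assumption).
    assert (Hsq : (-1) ^ m * (-1) ^ m = 1) by (rewrite <- Rpow_mult_distr, <- (pow1 m); f_equal; ring).
    set (p := a (s + m)%nat) in *; set (r := a (S (s + m))) in *.
    destruct (Rlt_le_dec (p * r) 0) as [Hlt|Hge].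
    - rewrite (sign_change_1 p r) by assumption; lia.
    - destruct (Req_EM_T r 0) as [->|Hr]; [rewrite (sign_change_zero p); lia|].
      destruct (Req_EM_T p 0) as [->|Hp]; [rewrite Rmult_0_r, sign_change_zero; lia|].
      assert (0 < p * r).
      { destruct Hge as [Hge|Hge]; [exact Hge|].
        symmetry in Hge; apply Rmult_integral in Hge; tauto. }
      rewrite sign_change_1; [lia|].
      replace ((-1) ^ S m * y ^ S m * r * ((-1) ^ m * y ^ m * p))
        with (- (((-1) ^ m * (-1) ^ m) * (y * y ^ m * y ^ m) * (p * r))) by (simpl; ring).
      rewrite Hsq, Rmult_1_l.
      assert (0 < y * y ^ m * y ^ m) by (repeat apply Rmult_lt_0_compat; assumption).
      nra. }
  specialize (H s (le_n s)); rewrite Nat.sub_diag in H.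
  unfold node_count; fold a; replace N with (2 * s + (N - 2 * s))%nat by lia.
  rewrite sign_changes_app; lia.
Qed.

Lemma node_count_const (N : nat) (a b y : R) :
  0 < y -> a <= b -> b < INR N - 1 - 2 * y ->
  (forall t, a <= t <= b -> h N t 0 y <> 0) -> node_count N a y = node_count N b y.
Proof.
  intros Hy Hab Hb Hnz; apply (locally_constant (fun t => node_count N t y)); [assumption|].
  intros t Ht; apply h_sign_changes_stable; [assumption | lra | lia | apply Hnz; lra].
Qed.

Lemma locally_left (P : R -> Prop) (a x : R) :
  a < x -> locally x P -> exists t, a < t < x /\ P t.
Proof.
  intros Hax [eps HP]; pose proof (cond_pos eps).
  set (t := Rmax ((a + x) / 2) (x - eps / 2)).
  assert (Ht : a < t < x /\ x - eps < t).
  { unfold t, Rmax; destruct (Rle_dec _ _); lra. }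
  exists t; split; [apply Ht|]; apply HP.
  unfold ball; simpl; unfold AbsRing_ball, abs, minus, plus, opp; simpl; apply Rabs_def1; lra.
Qed.

Lemma locally_right (P : R -> Prop) (b x : R) :
  x < b -> locally x P -> exists t, x < t < b /\ P t.
Proof.
  intros Hxb [eps HP]; pose proof (cond_pos eps).
  set (t := Rmin ((b + x) / 2) (x + eps / 2)).
  assert (Ht : x < t < b /\ t < x + eps).
  { unfold t, Rmin; destruct (Rle_dec _ _); lra. }
  exists t; split; [apply Ht|]; apply HP.
  unfold ball; simpl; unfold AbsRing_ball, abs, minus, plus, opp; simpl; apply Rabs_def1; lra.
Qed.

(** The right endpoint may be a zero of [h_0]: a vanishing first term is not counted, so the count
    is left-continuous. *)
Lemma node_count_const_left (N : nat) (a b y : R) :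
  0 < y -> (1 <= N)%nat -> a < b -> b < INR N - 1 - 2 * y ->
  (forall t, a <= t < b -> h N t 0 y <> 0) -> node_count N a y = node_count N b y.
Proof.
  intros Hy HN Hab Hb Hnz.
  destruct (Req_EM_T (h N b 0 y) 0) as [E|E].
  - destruct (locally_left _ a b Hab (node_count_jump N b y Hy Hb HN E)) as [t [Ht [_ Hc]]].
    rewrite <- Hc by lra; apply node_count_const; try lra.
    intros u Hu; apply Hnz; lra.
  - apply node_count_const; try lra.
    intros t Ht; destruct (Req_EM_T t b) as [->|]; [exact E | apply Hnz; lra].
Qed.

Lemma node_count_low (N : nat) (t y : R) : 0 <= y -> t <= - y -> node_count N t y = 0%nat.
Proof.
  intros Hy Ht; apply sign_changes_pos; intros i _.
  pose proof (pos_INR i); pose proof (pos_INR N); apply h_pos; lra.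
Qed.

(** * The count against the enumeration, below a cutoff [M] for which [N] is large enough *)

Section Enumeration.

Variables (N : nat) (M y : R) (lam : nat -> R).
Hypothesis Hy : 0 < y.
Hypothesis HN : (1 <= N)%nat.
Hypothesis HM : M <= INR N - 1 - 2 * y.
Hypothesis Hinc : forall i j, (1 <= i)%nat -> (i < j)%nat -> lam i < lam j.
Hypothesis Hzero : forall t, t < M -> (h N t 0 y = 0 <-> exists i, (1 <= i)%nat /\ t = lam i).

(** The count starts at zero far to the left and rises by one just after each zero, hence the weak
    inequality at [lam (S i)] and the strict one at [lam i]. *)
Lemma node_count_before (i : nat) (t : R) :
  t < M -> t <= lam (S i) -> (i = 0%nat \/ lam i < t) -> node_count N t y = i.
Proof.
  revert t; induction i as [|i IH]; intros t HtM Ht Hi.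
  - set (a := Rmin (t - 1) (- y)).
    assert (Ha : a < t /\ a <= - y) by (unfold a, Rmin; destruct (Rle_dec _ _); lra).
    rewrite <- (node_count_low N a y) by lra.
    symmetry; apply node_count_const_left; try lra; try assumption.
    intros u Hu E; apply Hzero in E as [j [Hj E]]; [|lra].
    destruct (Nat.eq_dec j 1) as [->|Hj1]; [lra|].
    pose proof (Hinc 1 j ltac:(lia) ltac:(lia)); lra.
  - destruct Hi as [Hi|Hi]; [discriminate|].
    assert (Hz : h N (lam (S i)) 0 y = 0).
    { apply Hzero; [lra|]; exists (S i); split; [lia | reflexivity]. }
    destruct (locally_right _ t (lam (S i)) Hi
                (node_count_jump N (lam (S i)) y Hy ltac:(lra) HN Hz)) as [u [Hu [Hc _]]].
    rewrite (IH (lam (S i))) in Hc; [|lra|lra|].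
    2:{ destruct i as [|i]; [left; reflexivity | right; apply Hinc; lia]. }
    rewrite <- Hc by lra; symmetry; apply node_count_const_left; try lra; try assumption.
    intros x Hx E; apply Hzero in E as [j [Hj E]]; [|lra].
    destruct (Nat.lt_trichotomy j (S i)) as [Hji|[->|Hji]]; [| lra |].
    + pose proof (Hinc j (S i) Hj Hji); lra.
    + destruct (Nat.eq_dec j (S (S i))) as [->|Hne]; [lra|].
      pose proof (Hinc (S (S i)) j ltac:(lia) ltac:(lia)); lra.
Qed.

(** An increasing sequence might accumulate below [M]; this is excluded because the count never
    exceeds [N]. *)
Lemma lam_exhausts : M <= lam (S (S N)).
Proof.
  apply Rnot_lt_le; intros Hlt.
  assert (E : node_count N (lam (S (S N))) y = S N).
  { apply node_count_before; [assumption | lra | right; apply Hinc; lia]. }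
  pose proof (sign_changes_le (fun n => h N (lam (S (S N))) n y) 0 N).
  unfold node_count in E; lia.
Qed.

Lemma node_count_index (t : R) : t < M ->
  exists i, node_count N t y = i /\ t <= lam (S i) /\ (i = 0%nat \/ lam i < t).
Proof.
  intros Ht.
  assert (H : forall k, t <= lam (S k) -> exists i, t <= lam (S i) /\ (i = 0%nat \/ lam i < t)).
  { induction k as [|k IH]; intros Hk; [exists 0%nat; auto|].
    destruct (Rle_lt_dec t (lam (S k))) as [Hle|Hlt]; [apply IH, Hle|].
    exists (S k); auto. }
  destruct (H (S N)) as [i [H1 H2]]; [pose proof lam_exhausts; lra|].
  exists i; split; [apply node_count_before; assumption | auto].
Qed.

Lemma node_count_ge (i : nat) (t : R) :
  (1 <= i)%nat -> t < M -> lam i < t -> (i <= node_count N t y)%nat.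
Proof.
  intros Hi Ht Hlt; destruct (node_count_index t Ht) as [j [-> [Hj _]]].
  apply Nat.nlt_ge; intros Hji.
  destruct (Nat.eq_dec i (S j)) as [->|Hne]; [lra|].
  pose proof (Hinc (S j) i ltac:(lia) ltac:(lia)); lra.
Qed.

Lemma node_count_lt (i : nat) (t : R) :
  (1 <= i)%nat -> t < M -> t < lam i -> (node_count N t y < i)%nat.
Proof.
  intros Hi Ht Hlt; destruct (node_count_index t Ht) as [j [-> [_ Hj]]].
  destruct Hj as [->|Hj]; [lia|].
  apply Nat.nle_gt; intros Hij.
  destruct (Nat.eq_dec i j) as [->|Hne]; [lra|].
  pose proof (Hinc i j ltac:(lia) ltac:(lia)); lra.
Qed.

End Enumeration.

(** * The decaying solution and the eigenvectors *)

Definition decaying (N : nat) (w mu : R) (n : nat) : R := (- w) ^ n * h N mu n (w ^ 2).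

Lemma decaying_rec (N : nat) (w mu : R) (n : nat) : mu < INR N + 1 ->
  w * (decaying N w mu n + decaying N w mu (S (S n))) =
  (mu - INR (S n)) * decaying N w mu (S n).
Proof.
  intros Hmu; unfold decaying; rewrite (h_rec N mu n), S_INR by assumption; simpl; ring.
Qed.

Lemma decaying_bound (N : nat) (w mu : R) (j : nat) :
  0 < w -> mu < INR N - 1 - 2 * w ^ 2 ->
  Rabs (decaying N w mu (N + j)) <= w ^ N * (1 / 4) ^ j.
Proof.
  intros Hw Hmu; unfold decaying.
  assert (Hw2 : 0 < w ^ 2) by (apply pow_lt; assumption).
  rewrite Rabs_mult, <- RPow_abs, Rabs_Ropp, (Rabs_pos_eq w) by lra.
  rewrite pow_add, Rmult_assoc; apply Rmult_le_compat_l; [apply pow_le; lra|].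
  assert (INR N <= INR (N + j)) by (apply le_INR; lia).
  apply Rle_trans with (w ^ j * / (2 + 2 * w ^ 2) ^ j).
  - apply Rmult_le_compat_l; [apply pow_le; lra|].
    eapply Rle_trans; [apply h_abs_le; lra|].
    rewrite Rabs_pos_eq; [apply q_bound_tail; lra | left; apply q_pos; lra].
  - rewrite <- pow_inv, <- Rpow_mult_distr; apply pow_incr; split.
    + apply Rmult_le_pos; [lra | left; apply Rinv_0_lt_compat; lra].
    + apply Rmult_le_reg_r with (2 + 2 * w ^ 2); [lra|].
      rewrite Rmult_assoc, Rinv_l by lra.
      (* The ratio [1 / 4] is the inequality [4 * w <= 2 + 2 * w ^ 2]. *)
      assert (0 <= (w - 1) ^ 2) by apply pow2_ge_0; lra.
Qed.

Lemma decaying_lim (N : nat) (w mu : R) :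
  0 < w -> mu < INR N - 1 - 2 * w ^ 2 -> is_lim_seq (decaying N w mu) 0.
Proof.
  intros Hw Hmu; apply is_lim_seq_incr_n with N, is_lim_seq_abs_0.
  apply is_lim_seq_le_le with (u := fun _ => 0) (w := fun j => w ^ N * (1 / 4) ^ j).
  - intros j; rewrite Nat.add_comm; split; [apply Rabs_pos | apply decaying_bound; assumption].
  - apply is_lim_seq_const.
  - replace (Finite 0) with (Rbar_mult (w ^ N) 0) by (simpl; f_equal; ring).
    apply is_lim_seq_scal_l, is_lim_seq_geom; rewrite Rabs_pos_eq; lra.
Qed.

(** The factor [INR (S n)] lets one estimate serve both [v] and [L v]; it costs at most [2 ^ j],
    leaving the ratio [1 / 2]. *)
Lemma decaying_l2 (N : nat) (w mu : R) (v : nat -> C) :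
  0 < w -> mu < INR N - 1 - 2 * w ^ 2 ->
  (forall n, Cmod (v n) <= INR (S n) * Rabs (decaying N w mu (S n))) -> l2 v.
Proof.
  intros Hw Hmu Hv; unfold l2; apply (ex_series_incr_n _ N).
  apply (ex_series_le (K := R_AbsRing) (V := R_CompleteNormedModule) _
           (fun j => ((INR N + 1) * w ^ N) ^ 2 * (1 / 4) ^ j)).
  - intros j; change (Rabs (Cmod (v (N + j)%nat) ^ 2) <= ((INR N + 1) * w ^ N) ^ 2 * (1 / 4) ^ j).
    rewrite Rabs_pos_eq by apply pow2_ge_0.
    replace ((1 / 4) ^ j) with (((1 / 2) ^ j) ^ 2)
      by (rewrite <- pow_mult, Nat.mul_comm, pow_mult; f_equal; field).
    rewrite <- Rpow_mult_distr; apply pow_incr; split; [apply Cmod_ge_0|].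
    eapply Rle_trans; [apply Hv|].
    assert (Hd : Rabs (decaying N w mu (S (N + j))) <= w ^ N * (1 / 4) ^ j).
    { rewrite <- Nat.add_succ_r; eapply Rle_trans; [apply decaying_bound; assumption|].
      apply Rmult_le_compat_l; [apply pow_le; lra|].
      assert (0 <= (1 / 4) ^ j) by (apply pow_le; lra); simpl; lra. }
    assert (Hj : INR (S j) <= 2 ^ j).
    { clear; induction j as [|j IH]; [simpl; lra|].
      rewrite S_INR; simpl pow; assert (1 <= 2 ^ j) by (apply pow_R1_Rle; lra); lra. }
    rewrite S_INR in Hj.
    assert (HNj : INR (S (N + j)) <= (INR N + 1) * 2 ^ j).
    { rewrite S_INR, plus_INR; pose proof (pos_INR N); pose proof (pos_INR j); nra. }
    apply Rle_trans with ((INR N + 1) * 2 ^ j * (w ^ N * (1 / 4) ^ j)).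
    + apply Rmult_le_compat; [apply pos_INR | apply Rabs_pos | assumption | assumption].
    + right; replace ((1 / 2) ^ j) with (2 ^ j * (1 / 4) ^ j)
        by (rewrite <- Rpow_mult_distr; f_equal; field); ring.
  - apply (ex_series_scal_l (((INR N + 1) * w ^ N) ^ 2) (fun j => (1 / 4) ^ j)), ex_series_geom.
    rewrite Rabs_pos_eq; lra.
Qed.

(** Entry 0 of [decaying] sits one place before the first coordinate, so [h_0 = 0] is the boundary
    condition. *)
Lemma zero_is_eigenvalue (N : nat) (w mu : R) :
  0 < w -> mu < INR N - 1 - 2 * w ^ 2 -> h N mu 0 (w ^ 2) = 0 -> is_eigenvalue_J w (RtoC mu).
Proof.
  intros Hw Hmu E.
  assert (Hw2 : 0 < w ^ 2) by (apply pow_lt; assumption).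
  exists (fun n => RtoC (decaying N w mu (S n))); split; [split|split].
  - apply (decaying_l2 N w mu); try assumption; intros n; rewrite Cmod_R.
    rewrite <- (Rmult_1_l (Rabs _)) at 1; apply Rmult_le_compat_r; [apply Rabs_pos|].
    apply (le_INR 1); lia.
  - apply (decaying_l2 N w mu); try assumption; intros n; unfold L.
    rewrite <- RtoC_mult, Cmod_R, Rabs_mult, Rabs_pos_eq by apply pos_INR; lra.
  - exists N; intros H; apply RtoC_inj in H; unfold decaying in H.
    apply Rmult_integral in H as [H|H]; [apply pow_nonzero in H; [assumption | lra]|].
    assert (0 < h N mu (S N) (w ^ 2)) by (apply h_tail_pos; (lra || lia)); lra.
  - intros n; unfold J, L, T.
    replace (match n with O => RtoC 0 | S m => RtoC (decaying N w mu (S m)) end)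
      with (RtoC (decaying N w mu n)).
    + rewrite <- RtoC_plus, <- !RtoC_mult, <- RtoC_plus; f_equal.
      rewrite decaying_rec by lra; ring.
    + destruct n as [|n]; [|reflexivity]; unfold decaying; rewrite E; f_equal; ring.
Qed.

(** The Casorati determinant of a bounded solution and the decaying one is constant and tends to
    zero. Its value is [h_0] times [x 0], and [x 0 = 0] would force [x] to vanish identically. *)
Lemma recessive_uniqueness (N : nat) (w mu B : R) (x : nat -> R) :
  0 < w -> mu < INR N - 1 - 2 * w ^ 2 -> (forall n, Rabs (x n) <= B) ->
  (forall n, INR (S n) * x n + w * (match n with O => 0 | S m => x m end + x (S n)) = mu * x n) ->
  (exists n, x n <> 0) -> h N mu 0 (w ^ 2) = 0.
Proof.
  intros Hw Hmu HB Hx [n0 Hn0].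
  assert (Hw2 : 0 < w ^ 2) by (apply pow_lt; assumption).
  set (u := decaying N w mu).
  set (prev := fun n => match n with O => 0 | S m => x m end).
  assert (HW : forall n, u n * x n - u (S n) * prev n = h N mu 0 (w ^ 2) * x 0%nat).
  { induction n as [|n IH]; [unfold u, decaying, prev; simpl; ring|].
    rewrite <- IH; apply Rmult_eq_reg_l with w; [|lra].
    pose proof (decaying_rec N w mu n ltac:(lra)) as Hu; fold u in Hu.
    pose proof (Hx n) as Hxn; fold (prev n) in Hxn.
    change (prev (S n)) with (x n).
    replace (w * (u (S n) * x (S n) - u (S (S n)) * x n))
      with (u (S n) * (w * (prev n + x (S n))) - u (S n) * w * prev n
            - (w * (u n + u (S (S n)))) * x n + w * u n * x n) by ring.
    rewrite Hu; replace (w * (prev n + x (S n))) with (mu * x n - INR (S n) * x n) by lra.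
    ring. }
  assert (HB0 : 0 <= B) by (eapply Rle_trans; [apply Rabs_pos | apply (HB 0%nat)]).
  assert (Hprev : forall n, Rabs (prev n) <= B).
  { intros [|n]; simpl; [rewrite Rabs_R0; assumption | apply HB]. }
  assert (H0 : h N mu 0 (w ^ 2) * x 0%nat = 0).
  { assert (Hlim : is_lim_seq (fun n => u n * x n - u (S n) * prev n) 0).
    { apply is_lim_seq_abs_0.
      apply is_lim_seq_le_le with (u := fun _ => 0)
        (w := fun n => B * Rabs (u n) + B * Rabs (u (S n))).
      - intros n; split; [apply Rabs_pos|].
        eapply Rle_trans; [apply Rabs_triang|]; rewrite Rabs_Ropp, !Rabs_mult.
        pose proof (Rmult_le_compat_l _ _ _ (Rabs_pos (u n)) (HB n)).
        pose proof (Rmult_le_compat_l _ _ _ (Rabs_pos (u (S n))) (Hprev n)); lra.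
      - apply is_lim_seq_const.
      - pose proof (decaying_lim N w mu Hw Hmu) as Hu; fold u in Hu.
        replace (Finite 0) with (Finite (B * 0 + B * 0)) by (f_equal; ring).
        apply (is_lim_seq_plus' (fun n => B * Rabs (u n)) (fun n => B * Rabs (u (S n))));
          apply (is_lim_seq_scal_l (fun n => Rabs (u _)) B 0);
          apply -> is_lim_seq_abs_0; [exact Hu | apply -> is_lim_seq_incr_1; exact Hu]. }
    apply is_lim_seq_ext with (v := fun _ => h N mu 0 (w ^ 2) * x 0%nat) in Hlim; [|exact HW].
    apply is_lim_seq_unique in Hlim; rewrite Lim_seq_const in Hlim; injection Hlim; auto. }
  apply Rmult_integral in H0 as [H0|H0]; [exact H0|exfalso].
  apply Hn0.
  assert (Hall : forall n, x n = 0 /\ x (S n) = 0); [|apply Hall].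
  induction n as [|n [IH1 IH2]].
  - split; [exact H0|]; pose proof (Hx 0%nat) as H1; rewrite H0 in H1; simpl in H1; nra.
  - split; [exact IH2|]; pose proof (Hx (S n)) as H1; simpl in H1; rewrite IH1, IH2 in H1; nra.
Qed.

Lemma eigenvalue_is_zero (N : nat) (w mu : R) :
  0 < w -> mu < INR N - 1 - 2 * w ^ 2 -> is_eigenvalue_J w (RtoC mu) -> h N mu 0 (w ^ 2) = 0.
Proof.
  intros Hw Hmu [v [[Hl2 _] [[n0 Hn0] HJ]]].
  assert (HB : exists B, forall n, Cmod (v n) <= B).
  { apply ex_series_lim_0, is_lim_seq_Reals in Hl2.
    destruct (maj_by_pos _ (exist _ 0 Hl2)) as [B [HB HvB]].
    exists (1 + B); intros n; specialize (HvB n).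
    rewrite Rabs_pos_eq in HvB by apply pow2_ge_0.
    pose proof (Cmod_ge_0 (v n)); nra. }
  destruct HB as [B HB].
  (* As [w] and [mu] are real, real and imaginary parts solve the recurrence separately, and one of
     them is nonzero. *)
  destruct (Req_EM_T (fst (v n0)) 0) as [E1|E1].
  - apply (recessive_uniqueness N w mu B (fun n => snd (v n))); try assumption.
    + intros n; eapply Rle_trans; [|apply HB].
      eapply Rle_trans; [apply Rmax_r | apply Rmax_Cmod].
    + intros n; pose proof (f_equal snd (HJ n)) as E; unfold J, L, T in E.
      destruct n; cbn [Cmult Cplus RtoC fst snd] in *; lra.
    + exists n0; intros E2; apply Hn0; destruct (v n0); simpl in *; subst; reflexivity.
  - apply (recessive_uniqueness N w mu B (fun n => fst (v n))); try assumption.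
    + intros n; eapply Rle_trans; [|apply HB].
      eapply Rle_trans; [apply Rmax_l | apply Rmax_Cmod].
    + intros n; pose proof (f_equal fst (HJ n)) as E; unfold J, L, T in E.
      destruct n; cbn [Cmult Cplus RtoC fst snd] in *; lra.
    + exists n0; exact E1.
Qed.

(** * Deformation to coupling zero and the two-sided bound *)

Lemma node_count_upper (N m : nat) (d w : R) :
  (m < N)%nat -> 0 < d <= 1 / 2 -> 0 < w -> INR (S m) + 2 * (w + 1) ^ 2 < INR N - 1 ->
  w ^ (2 * S m) <= sin (PI * d) / PI * INR (fact (S m)) * INR (fact m) ->
  (node_count N (INR (S m) - d) (w ^ 2) <= m)%nat.
Proof.
  intros HmN Hd Hw HN Hws.
  set (mu := INR (S m) - d).
  assert (Hsq : forall t, 0 <= t < w + 1 -> t ^ 2 <= (w + 1) ^ 2) by (intros; apply pow_incr; lra).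
  assert (Hmu : forall t, t ^ 2 <= (w + 1) ^ 2 -> mu < INR N - 1 - 2 * t ^ 2)
    by (intros t Ht; unfold mu; lra).
  assert (Hnz : forall t, 0 <= t <= w -> h N mu 0 (t ^ 2) <> 0).
  { intros t Ht; apply h_0_nonzero; [assumption | assumption | apply pow2_ge_0 |].
    eapply Rle_trans; [|exact Hws]; rewrite <- pow_mult; apply pow_incr; exact Ht. }
  assert (E : node_count N mu (0 ^ 2) = node_count N mu (w ^ 2)).
  { apply (locally_constant (fun t => node_count N mu (t ^ 2)) 0 w); [lra|].
    intros t Ht.
    apply (sign_changes_stable (fun u n => h N mu n (u ^ 2)) N t); [| | |lia|apply Hnz; lra].
    - intros n; apply (continuous_comp (fun u => u ^ 2) (h N mu n)).
      + apply (ex_derive_continuous (fun u => u ^ 2)); auto_derive; exact I.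
      + apply continuous_h_y; specialize (Hmu t (Hsq t ltac:(lra))).
        pose proof (pow2_ge_0 t); lra.
    - exists (mkposreal 1 Rlt_0_1); intros u Hu n Hn.
      apply h_tail_pos; [apply pow2_ge_0 | | assumption].
      apply Hmu.
      unfold ball in Hu; simpl in Hu; unfold AbsRing_ball, abs, minus, plus, opp in Hu; simpl in Hu.
      apply Rabs_def2 in Hu; nra.
    - intros n Hn; specialize (Hmu t (Hsq t ltac:(lra))).
      destruct (Req_EM_T t 0) as [->|Ht0].
      (* At coupling 0 the recurrence loses its last term and no longer separates the signs around a
         zero; but [mu] is not an integer, so no entry vanishes. *)
      + exfalso; revert Hn; replace (0 ^ 2) with 0 by ring; rewrite h_0; intros Hn.
        destruct (Nat.le_gt_cases m (S n)) as [Hle|Hgt].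
        * assert (0 < q N mu (S n)); [|lra].
          apply q_pos; [simpl in Hmu; lra|].
          apply le_INR in Hle; unfold mu; rewrite S_INR; lra.
        * unfold mu in Hn; replace (S n) with (m - (m - S n))%nat in Hn by lia.
          rewrite q_below in Hn by (lia || lra).
          assert (0 < rising (1 - d) (m - S n)) by (apply rising_pos; lra).
          assert (0 < q N (INR (S m) - d) m).
          { apply q_pos; fold mu; [simpl in Hmu; lra | unfold mu; rewrite S_INR; lra]. }
          apply Rmult_integral in Hn as [Hn|Hn]; [|lra].
          apply Rmult_integral in Hn as [Hn|Hn]; [|lra].
          revert Hn; apply pow_nonzero; lra.
      + apply h_interior_zero; [apply pow_lt; lra | assumption | assumption]. }
  assert (Hsplit : forall a, sign_changes a 0 N = (sign_changes a 0 m + sign_changes a m (N - m))%nat).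
  { intros a; replace N with (m + (N - m))%nat at 1 by lia; apply sign_changes_app. }
  (* At coupling 0 the entries are positive from index [m] on, since [mu < m + 1]; only the first
     [m] steps can count. *)
  rewrite <- E; unfold node_count; rewrite Hsplit, (sign_changes_pos _ m).
  - pose proof (sign_changes_le (fun n => h N mu n (0 ^ 2)) 0 m); lia.
  - intros i Hi; replace (0 ^ 2) with 0 by ring; rewrite h_0.
    apply le_INR in Hi; simpl in Hi; specialize (Hmu 0 (Hsq 0 ltac:(lra))).
    apply q_pos; [simpl in Hmu; lra | unfold mu; rewrite S_INR; lra].
Qed.

Lemma eigenvalues_at_0 (lam : nat -> R) :
  ascending_eigenvalues_J 0 lam -> forall s, (1 <= s)%nat -> lam s = INR s.
Proof.
  intros [Hinc Heig].
  assert (Hint : forall z : C, is_eigenvalue_J 0 z <-> exists n, z = RtoC (INR (S n))).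
  { intros z; split.
    - intros [v [_ [[n Hn] HJ]]]; exists n.
      specialize (HJ n); unfold J, L in HJ; rewrite Cmult_0_l, Cplus_0_r in HJ.
      assert (E : ((RtoC (INR (S n)) - z) * v n = 0)%C).
      { unfold Cminus; rewrite Cmult_plus_distr_r, HJ; ring. }
      destruct (Ceq_dec (RtoC (INR (S n)) - z) 0) as [E'|E'].
      + replace z with (RtoC (INR (S n)) - (RtoC (INR (S n)) - z))%C by ring.
        rewrite E'; ring.
      + exfalso; apply (Cmult_neq_0 _ _ E' Hn E).
    - intros [n ->].
      set (v := fun k => if Nat.eq_dec k n then RtoC 1 else RtoC 0).
      assert (Hfin : forall u : nat -> C, (forall k, k <> n -> u k = RtoC 0) -> l2 u).
      { intros u Hu; unfold l2; apply (ex_series_incr_n _ (S n)).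
        apply ex_series_ext with (a := fun _ => 0).
        - intros k; rewrite Hu, Cmod_0 by lia; simpl; ring.
        - exists 0; apply is_series_Reals; intros e He; exists 0%nat; intros k _.
          unfold R_dist; rewrite sum_eq_R0 by reflexivity; rewrite Rminus_0_r, Rabs_R0; exact He. }
      assert (Hv : forall k, k <> n -> v k = RtoC 0)
        by (intros k Hk; unfold v; destruct (Nat.eq_dec k n); [contradiction | reflexivity]).
      exists v; split; [split|split].
      + apply Hfin, Hv.
      + apply Hfin; intros k Hk; unfold L; rewrite Hv by assumption; ring.
      + exists n; unfold v; destruct (Nat.eq_dec n n); [|contradiction].
        intros E; apply RtoC_inj in E; lra.
      + intros k; unfold J, L; rewrite Cmult_0_l, Cplus_0_r.
        destruct (Nat.eq_dec k n) as [->|Hk]; [reflexivity|].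
        rewrite (Hv k Hk); ring. }
  assert (Hlam : forall i, (1 <= i)%nat -> exists n, (1 <= n)%nat /\ lam i = INR n).
  { intros i Hi; destruct (proj1 (Hint (RtoC (lam i)))) as [n Hn].
    - apply Heig; exists i; auto.
    - apply RtoC_inj in Hn; exists (S n); split; [lia | exact Hn]. }
  assert (Hge : forall i, (1 <= i)%nat -> INR i <= lam i).
  { induction i as [|i IH]; intros Hi; [lia|].
    destruct (Hlam (S i) Hi) as [n [Hn E]].
    destruct (Nat.eq_dec i 0) as [->|Hi0]; [rewrite E; apply le_INR; exact Hn|].
    pose proof (IH ltac:(lia)); pose proof (Hinc i (S i) ltac:(lia) ltac:(lia)).
    rewrite E; apply le_INR, INR_lt; lra. }
  (* Now [s] equals some [lam j]: [j < s] contradicts the induction hypothesis, and [j > s]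
     contradicts [lam s >= s]. *)
  intros s; induction s as [s IH] using (well_founded_induction Wf_nat.lt_wf); intros Hs.
  destruct (proj1 (Heig (RtoC (INR s)))) as [j [Hj E]].
  { apply Hint; exists (s - 1)%nat; do 2 f_equal; lia. }
  apply RtoC_inj in E.
  destruct (Nat.lt_trichotomy j s) as [Hlt|[->|Hgt]]; [|auto|].
  - rewrite (IH j Hlt Hj) in E; apply INR_eq in E; lia.
  - pose proof (Hinc s j Hs Hgt); pose proof (Hge s Hs); lra.
Qed.

Lemma eigenvalue_location (lam : nat -> R) (m : nat) (w d : R) :
  0 < w -> ascending_eigenvalues_J w lam -> 0 < d <= 1 / 2 ->
  w ^ (2 * S m) <= sin (PI * d) / PI * INR (fact (S m)) * INR (fact m) ->
  INR (S m) - d <= lam (S m) <= INR (S m).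
Proof.
  intros Hw [Hinc Heig] Hd Hws.
  destruct (INR_unbounded (INR (S m) + 3 + 2 * (w + 1) ^ 2)) as [N0 HN0].
  (* The summand [2 * S m] makes room for all mirror pairs in [node_count_integer]. *)
  set (N := (N0 + 2 * S m)%nat).
  assert (HN : INR (S m) + 3 + 2 * (w + 1) ^ 2 < INR N).
  { eapply Rlt_le_trans; [exact HN0|]; apply le_INR; unfold N; lia. }
  assert (Hw2 : 0 < w ^ 2 <= (w + 1) ^ 2) by (split; [apply pow_lt; lra | apply pow_incr; lra]).
  set (M := INR (S m) + 1).
  assert (HM : M <= INR N - 1 - 2 * w ^ 2) by (unfold M; lra).
  assert (Hzero : forall t, t < M -> (h N t 0 (w ^ 2) = 0 <-> exists i, (1 <= i)%nat /\ t = lam i)).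
  { intros t Ht; split.
    - intros E; destruct (proj1 (Heig (RtoC t))) as [i [Hi E']].
      + apply (zero_is_eigenvalue N); (assumption || lra).
      + exists i; split; [exact Hi | apply RtoC_inj, E'].
    - intros [i [Hi ->]]; apply eigenvalue_is_zero; [assumption | lra|].
      apply Heig; exists i; auto. }
  assert (H1N : (1 <= N)%nat) by (unfold N; lia).
  split; apply Rnot_lt_le; intros Hlt.
  - pose proof (node_count_ge N M (w ^ 2) lam (proj1 Hw2) H1N HM Hinc Hzero (S m)
                  (INR (S m) - d) ltac:(lia) ltac:(unfold M; lra) Hlt).
    pose proof (node_count_upper N m d w ltac:(unfold N; lia) Hd Hw ltac:(lra) Hws); lia.
  - pose proof (node_count_lt N M (w ^ 2) lam (proj1 Hw2) H1N HM Hinc Hzero (S m)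
                  (INR (S m)) ltac:(lia) ltac:(unfold M; lra) Hlt).
    pose proof (node_count_integer N (S m) (w ^ 2) (proj1 Hw2) ltac:(lra) ltac:(unfold N; lia)); lia.
Qed.

Lemma beta_pow (s : nat) : (1 <= s)%nat ->
  beta s ^ (2 * s) = INR (fact (s - 1)) * INR (fact s) / PI.
Proof.
  intros Hs; pose proof PI_RGT_0; unfold beta.
  assert (0 < INR (fact (s - 1)) * INR (fact s) / PI).
  { apply Rdiv_lt_0_compat; [apply Rmult_lt_0_compat; apply INR_fact_lt_0 | assumption]. }
  rewrite <- Rpower_pow by apply exp_pos.
  rewrite Rpower_mult, mult_INR.
  assert (1 <= INR s) by (apply (le_INR 1); assumption).
  replace (1 / (2 * INR s) * (INR 2 * INR s)) with 1 by (simpl; field; lra).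
  apply Rpower_1; assumption.
Qed.

Theorem proposition33
  (lambda : nat -> R -> R)
  (Hlambda : forall w : R, 0 <= w ->
     ascending_eigenvalues_J w (fun s => lambda s w))
  (s : nat) (hs : (1 <= s)%nat)
  (w : R) (hw : 0 <= w <= beta s) :
  0 <= INR s - lambda s w
    <= 1 / PI * asin (PI * w ^ (2 * s) / (INR (fact (s - 1)) * INR (fact s))).
Proof.
  pose proof PI_RGT_0 as Hpi.
  (* For [w = 0] the solution [decaying] degenerates, and the spectrum is read off the diagonal. *)
  destruct (Req_EM_T w 0) as [->|Hw0].
  - rewrite (eigenvalues_at_0 _ (Hlambda 0 (Rle_refl 0)) s hs), pow_i by lia.
    unfold Rdiv; rewrite Rmult_0_r, Rmult_0_l, asin_0; lra.
  - destruct s as [|m]; [lia|].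
    replace (S m - 1)%nat with m by lia.
    pose proof (beta_pow (S m) hs) as Hbeta; replace (S m - 1)%nat with m in Hbeta by lia.
    pose proof (INR_fact_lt_0 m) as Hf; pose proof (INR_fact_lt_0 (S m)) as HfS.
    set (c := INR (fact m) * INR (fact (S m))) in *.
    assert (Hc : 0 < c) by (apply Rmult_lt_0_compat; assumption).
    set (x := PI * w ^ (2 * S m) / c).
    assert (Hwpos : 0 < w ^ (2 * S m)) by (apply pow_lt; lra).
    assert (Hx : 0 < x <= 1).
    { split; [apply Rdiv_lt_0_compat; [apply Rmult_lt_0_compat|]; assumption|].
      assert (Hle : w ^ (2 * S m) <= c / PI) by (rewrite <- Hbeta; apply pow_incr; exact hw).
      unfold x; apply Rmult_le_reg_r with c; [assumption|].
      unfold Rdiv; rewrite Rmult_assoc, Rinv_l, Rmult_1_r, Rmult_1_l by lra.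
      apply Rmult_le_compat_l with (r := PI) in Hle; [|lra].
      replace (PI * (c / PI)) with c in Hle by (field; lra); exact Hle. }
    pose proof (sin_asin x ltac:(lra)) as Hsin.
    pose proof (asin_bound x) as Hab.
    assert (Hpos : 0 < asin x).
    { destruct (Rle_lt_dec (asin x) 0) as [Hle|]; [|assumption].
      destruct Hle as [Hlt|E]; [|rewrite E, sin_0 in Hsin; lra].
      pose proof (sin_lt_0_var (asin x) ltac:(lra) Hlt); lra. }
    (* With this [d] the hypothesis of [eigenvalue_location] holds with equality; [w <= beta]
       amounts to [x <= 1] and yields [d <= 1 / 2]. *)
    set (d := 1 / PI * asin x).
    assert (Epd : PI * d = asin x) by (unfold d; field; lra).
    assert (Hd : 0 < d <= 1 / 2) by (split; nra).
    assert (Hws : w ^ (2 * S m) <= sin (PI * d) / PI * INR (fact (S m)) * INR (fact m)).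
    { right; rewrite Epd, Hsin; unfold x, c; field; repeat split; lra. }
    pose proof (eigenvalue_location (fun s => lambda s w) m w d ltac:(lra)
                  (Hlambda w (proj1 hw)) Hd Hws) as H.
    cbv beta in H; lra.
Qed.
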